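(* Let $\Sigma:\ \frac{dx}{dt}=A_{r(t)}x(t)$ be a positive Markovian jump linear system and let $m$ be a positive integer. Then $\Sigma$ is exponentially $m$-th mean stable if and only if the matrix $$\mathcal T_m:=Q^\top\otimes I_{n_m}+\operatorname{diag}\big((A_1)_{[m]},\dots,(A_N)_{[m]}\big)\in\mathbb R^{(n_mN)\times(n_mN)}$$ is Hurwitz stable, i.e. all its eigenvalues have negative real part.
   Context: Setting. $\{r(t)\}_{t\ge0}$ is a continuous-time homogeneous Markov process with values in $\{1,\dots,N\}$ such that, for $h>0$, $P(r(t+h)=j\mid r(t)=i)=q_{ij}h+o(h)$ for $i\ne j$ and $=1+q_{ii}h+o(h)$ for $i=j$, where $q_{ij}\ge0$ for $i\ne j$ and $q_{ii}=-\sum_{j\ne i}q_{ij}$. $Q=[q_{ij}]$ is the infinitesimal generator. $A_1,\dots,A_N$ are real $n\times n$ matrices. The differential equation $\frac{dx}{dt}=A_{r(t)}x(t)$ with constant $x(0)=x_0\in\mathbb R^n$ and constant $r(0)=r_0\in\{1,\dots,N\}$ is a Markovian jump linear system; it is positive if every $A_i$ is Metzler (off-diagonal entries nonnegative). Stability. $\Sigma$ is exponentially $m$-th mean stable if there exist $C>0$, $\beta>0$ such that $E[\|x(t)\|^m]\le Ce^{-\beta t}\|x_0\|^m$ for all $t\ge0$, all $x_0\in\mathbb R^n$ and all $r_0\in\{1,\dots,N\}$ (the choice of norm is immaterial). Notation. $n_m=\binom{n+m-1}{m}$. For $x\in\mathbb R^n$, $x^{[m]}\in\mathbb R^{n_m}$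 is the vector of all lexicographically ordered degree-$m$ monomials in $x_1,\dots,x_n$, with positive coefficients chosen so that $\|x\|_2^m=\|x^{[m]}\|_2$ (the coefficient of $x_1^{a_1}\cdots x_n^{a_n}$ is $\sqrt{m!/(a_1!\cdots a_n!)}$). For $A\in\mathbb R^{n\times n}$, $A_{[m]}\in\mathbb R^{n_m\times n_m}$ is the unique matrix such that every differentiable $x:\mathbb R\to\mathbb R^n$ with $\frac{dx}{dt}=Ax$ satisfies $\frac{dx^{[m]}}{dt}=A_{[m]}x^{[m]}$. $\otimes$ is the Kronecker product and $\operatorname{diag}$ denotes a block-diagonal matrix. *)

(* Defs.v *)
From HB Require Import structures.
From mathcomp Require Import all_boot all_order all_algebra.
From mathcomp Require Import all_classical all_reals all_analysis.
From mathcomp Require Import complex mxtens.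

Set Implicit Arguments.
Unset Strict Implicit.
Unset Printing Implicit Defensive.

Import Order.TTheory GRing.Theory Num.Theory.
Import numFieldNormedType.Exports.

Local Open Scope classical_set_scope.
Local Open Scope ring_scope.

Definition metzler (R : realType) (n : nat) (A : 'M[R]_n) : Prop :=
  forall i j, i != j -> 0 <= A i j.

Definition hurwitz (R : realType) (n : nat) (M : 'M[R]_n) : Prop :=
  forall z : complex R,
    eigenvalue (map_mx (real_complex R) M) z -> complex.Re z < 0.

Definition generator (R : realType) (N : nat) (Q : 'M[R]_N) : Prop :=
  (forall i j, i != j -> 0 <= Q i j) /\
  (forall i, Q i i = - \sum_(j < N | j != i) Q i j).

Definition nmon (n m : nat) : nat := 'C((n + m).-1, m).

(* The exponents of the degree m monomials in n variables, in decreasing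
   lexicographic order, so that x_1 ^ m comes first. *)
Definition exponents (n m : nat) : seq (n.-tuple 'I_m.+1) :=
  sort (fun a b => (b <= a :> n.-tuplelexi 'I_m.+1)%O)
    (enum [set a : n.-tuple 'I_m.+1 | \sum_(i <- a) i == m]%N%SET).

Lemma size_exponents (n m : nat) : size (exponents n m) = nmon n m.
Proof.
rewrite size_sort -cardE /nmon; case: n => [|n]; last first.
  by rewrite card_ord_partitions addSn/= -bin_sub ?leq_addr// addKn.
case: m => [|m].
  rewrite bin0; apply/eqP/cards1P; exists [tuple].
  by apply/setP => a; rewrite finset.in_set finset.in_set1 tuple0 big_nil; apply/esym/eqP.
rewrite bin_small//; apply/eqP; rewrite cards_eq0; apply/eqP/setP => a.
by rewrite finset.in_set finset.in_set0 tuple0 big_nil.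
Qed.

(* x^[m]; the coefficients are those for which the Euclidean norms satisfy
   ||x^[m]|| = ||x|| ^ m. *)
Definition vpow (R : realType) (n m : nat) (x : 'cV[R]_n) : 'cV[R]_(nmon n m) :=
  \col_k let a := nth [tuple ord0 | _ < n] (exponents n m) k in
    Num.sqrt ((m`!)%:R / (\prod_(i < n) (tnth a i)`!)%:R) *
    \prod_(i < n) x i 0 ^+ tnth a i.

(* A_[m], by definite description; 0 is the value that would be returned if no
   such matrix existed. *)
Definition mlift (R : realType) (n m : nat) (A : 'M[R]_n) :
    'M[R]_(nmon n m) :=
  xget 0 [set B : 'M[R]_(nmon n m) | forall x : R -> 'cV[R]_n,
    (forall t : R, is_derive t 1 x (A *m x t)) ->
    forall t : R, is_derive t 1 (fun s => vpow m (x s)) (B *m vpow m (x t))].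

Lemma block_dim (N k : nat) : (\sum_(i < N) k = N * k)%N.
Proof. by rewrite sum_nat_const card_ord. Qed.

(* mxdiag has dimension \sum_(i < N) k; the cast gives it the index type of
   Kronecker products. *)
Definition block_diag (R : realType) (N k : nat) (B : 'I_N -> 'M[R]_k) :
    'M[R]_(N * k) :=
  castmx (block_dim N k, block_dim N k) (\mxdiag_(i < N) B i).

Lemma block_diagE (R : realType) (N k : nat) (B : 'I_N -> 'M[R]_k)
    (i j : 'I_N) (u v : 'I_k) :
  block_diag B (mxtens_index (i, u)) (mxtens_index (j, v)) =
  if i == j then B i u v else 0.
Proof.
have idx (l : 'I_N) (w : 'I_k) :
    cast_ord (esym (block_dim N k)) (mxtens_index (l, w)) =
    @tagnat.Rank N (fun=> k) l w.
  apply: val_inj; rewrite [RHS]tagnat.RankEsum /= sum_nat_cond_const.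
  congr (_ * _ + _)%N; have /= := big_ord_narrow (ltnW (ltn_ord l)).
  move=> /(_ nat 0%N addn (fun=> 1%N)) E.
  by rewrite -sum1_card; under [RHS]eq_bigl do rewrite inE; rewrite E sum1_card card_ord.
rewrite castmxE !idx /mxdiag.
have /matrixP/(_ u v) := mxblockK
  (fun a b => if a == b then conform_mx 0 (B a) else 0 : 'M[R]_k) i j.
by rewrite mxE => ->; case: eqP => _; rewrite ?conform_mx_id// mxE.
Qed.

Definition Tmx (R : realType) (N n m : nat) (Q : 'M[R]_N)
    (A : 'I_N -> 'M[R]_n) : 'M[R]_(N * nmon n m) :=
  Q^T *t 1%:M + block_diag (fun i => mlift m (A i)).

Section process.
Variables (d : measure_display) (T : measurableType d) (R : realType).
Variable N : nat.
Implicit Types (P : probability T R) (r : R -> T -> 'I_N).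

Definition cprob P (E F : set T) : R := fine (P (E `&` F)) / fine (P F).

Definition in_state r (t : R) (i : 'I_N) : set T := [set w | r t w = i].

Definition follows r (s : seq (R * 'I_N)) : set T :=
  [set w | forall p, p \in s -> r p.1 w = p.2].

(* A path of the chain is a right-continuous step function on [0, +oo[. *)
Definition step_path (rho : R -> 'I_N) : Prop :=
  (forall t : R, 0 <= t -> \forall s \near t^'+, rho s = rho t) /\
  (forall t : R, 0 < t -> exists i, \forall s \near t^'-, rho s = i).

(* r is only meaningful at nonnegative times. Conditional probabilities are
   constrained only where the conditioning event has positive probability. *)
Record markov_chain P (Q : 'M[R]_N) (i0 : 'I_N) r : Prop := MarkovChain {
  mc_measurable : forall (t : R) (i : 'I_N), 0 <= t -> measurable (in_state r t i);
  mc_init : P (in_state r 0 i0) = 1%E;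
  mc_markov : forall (past : seq (R * 'I_N)) (t u : R) (i j : 'I_N),
    (forall p, p \in past -> 0 <= p.1 <= t) -> 0 <= t -> t <= u ->
    P (follows r past `&` in_state r t i) != 0%E ->
    cprob P (in_state r u j) (follows r past `&` in_state r t i) =
    cprob P (in_state r u j) (in_state r t i);
  mc_homogeneous : forall (s t h : R) (i j : 'I_N),
    0 <= s -> 0 <= t -> 0 <= h ->
    P (in_state r s i) != 0%E -> P (in_state r t i) != 0%E ->
    cprob P (in_state r (s + h) j) (in_state r s i) =
    cprob P (in_state r (t + h) j) (in_state r t i);
  mc_generator : forall (t : R) (i j : 'I_N),
    0 <= t -> P (in_state r t i) != 0%E ->
    (cprob P (in_state r (t + h) j) (in_state r t i) - (i == j)%:R) / h
      @[h --> 0^'+] --> Q i j;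
  mc_path : \forall w \ae P, step_path (r ^~ w) }.

Variable n : nat.

(* y solves dy/dt = A_rho(t) y on [0, +oo[: it is continuous there, and
   satisfies the equation at every time that is not a jump of rho. *)
Definition solves (A : 'I_N -> 'M[R]_n) (rho : R -> 'I_N) (x0 : 'cV[R]_n)
    (y : R -> 'cV[R]_n) : Prop :=
  [/\ y 0 = x0,
      {within `[0, +oo[, continuous y} &
      forall t : R, 0 < t -> (\forall s \near t, rho s = rho t) ->
        is_derive t 1 y (A (rho t) *m y t)].

Definition trajectory P (A : 'I_N -> 'M[R]_n) r (x0 : 'cV[R]_n)
    (x : R -> T -> 'cV[R]_n) : Prop :=
  (forall (t : R) (k : 'I_n), 0 <= t -> measurable_fun setT (fun w => x t w k 0)) /\
  (\forall w \ae P, solves A (r ^~ w) x0 (x ^~ w)).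

(* `| _ | is the sup norm on R^n. P i0 is the law under which the chain starts
   in i0, and x i0 x0 is the state process with r(0) = i0 and x(0) = x0. *)
Definition exp_mean_stable (P : 'I_N -> probability T R)
    (x : 'I_N -> 'cV[R]_n -> R -> T -> 'cV[R]_n) (m : nat) : Prop :=
  exists C beta : R, [/\ 0 < C, 0 < beta &
    forall (i0 : 'I_N) (x0 : 'cV[R]_n) (t : R), 0 <= t ->
      ('E_(P i0)[fun w => (`|x i0 x0 t w| ^+ m)%R]
        <= (C * expR (- (beta * t)) * `|x0| ^+ m)%R%:E)%E].

End process.

(* Main.v *)
Require Import Defs.
From mathcomp Require Import all_boot all_order all_algebra.
From mathcomp Require Import all_classical all_reals all_analysis.
From mathcomp Require Import measurable_realfun.
From mathcomp Require Import complex mxtens ring lra.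

Set Implicit Arguments.
Unset Strict Implicit.
Unset Printing Implicit Defensive.

Import Order.TTheory GRing.Theory Num.Theory.
Import numFieldNormedType.Exports.

Local Open Scope classical_set_scope.
Local Open Scope ring_scope.

(** Write y_i(t) for the expectation of x(t)^[m] on the event r(t) = i, and y
    for the stacked vector of the y_i. The theorem holds because y solves the
    linear equation y' = T_m y: the chain moves mass between the blocks at the
    rates Q, and inside block i the monomials evolve by the matrix A_i lifted to
    degree m. Mean stability is then decay of y, that is, T_m is Hurwitz.

    The evolution of y is obtained by discretizing time. The Euler scheme with
    step h = t / K replaces x(t) by the product of the K matrices 1 + h A_i, with
    i the state of the chain at the grid points. A path has finitely many jumps
    before t, so the scheme has error O(h) along each path ([euler_error]); it is
    bounded uniformly in the path, and its m-th moment therefore tends to that of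
    x(t) by dominated convergence ([moment_limit]). For a fixed step the scheme
    depends on the chain at K times only, and the Markov property turns its
    expectations into a finite recursion over the transition matrix p(h)
    ([euler_law]). On functionals that are linear in the degree m monomials, this
    recursion is the K-th power of a matrix M(h) whose blocks are p_ij(h) times
    the symmetric power of 1 + h A_i ([scheme_mean_momentmx]). As
    M(h) = 1 + h T_m + o(h) ([momentmx_generator]), the K-th powers of M(h) and of
    1 + h T_m have the same behaviour as K grows ([iter_mulmx_euler]).

    If T_m is Hurwitz, a triangular form of T_m over the complex numbers shows
    that (1 + h T_m)^K is bounded by a multiple of exp (- b t) ([hurwitz_decay]).
    Positivity transfers this to the norm of x: for small h the matrices 1 + h A_i
    are nonnegative, so the scheme started at x0 is dominated entrywise by the one
    started at |x0|, and for a nonnegative vector the m-th power of the norm is at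
    most the sum of the m-th powers of the entries, a linear functional of the
    monomials ([hurwitz_stable]).

    Conversely, let v be a left eigenvector of T_m for an eigenvalue z with
    nonnegative real part. Then v (1 + h T_m)^K y(0) = (1 + h z)^K v y(0) has
    modulus at least that of v y(0). The monomials being linearly independent
    ([vpow_span]), some initial state and some x0 make v y(0) nonzero, and then the
    m-th moment of x(t) cannot tend to 0 ([stable_hurwitz]). *)

(** * Sizes of matrices and the Euler scheme *)

Section matrix_size.
Variable R : realType.

Lemma entry_le_norm n (z : 'cV[R]_n) k : `|z k 0| <= `|z|.
Proof.
rewrite [leRHS]/Num.Def.normr/= mx_normrE.
exact: (le_bigmax _ (fun ij => `|z ij.1 ij.2|) (k, 0)).
Qed.

Lemma norm_le_entries n (z : 'cV[R]_n) (c : R) :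
  0 <= c -> (forall k, `|z k 0| <= c) -> `|z| <= c.
Proof.
move=> c0 zc; rewrite [leLHS]/Num.Def.normr/= mx_normrE.
by apply: bigmax_le => //= -[k l] _ /=; rewrite (ord1 l).
Qed.

(** A crude bound for the operator norm, used because the norm of the library is
    the largest entry, which is not submultiplicative. *)
Definition mxsize p q (M : 'M[R]_(p, q)) : R := \sum_i \sum_j `|M i j|.

Lemma mxsize_ge0 p q (M : 'M[R]_(p, q)) : 0 <= mxsize M.
Proof. by apply: sumr_ge0 => i _; apply: sumr_ge0. Qed.

Lemma mulmx_norm_le p q (M : 'M[R]_(p, q)) (z : 'cV[R]_q) :
  `|M *m z| <= mxsize M * `|z|.
Proof.
apply: norm_le_entries => [|k]; first by rewrite mulr_ge0// mxsize_ge0.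
rewrite mxE (le_trans (ler_norm_sum _ _ _))// /mxsize (bigD1 k)//= mulrDl.
rewrite -[leLHS]addr0 lerD//; last first.
  by rewrite mulr_ge0//; apply: sumr_ge0 => i _; apply: sumr_ge0.
rewrite mulr_suml; apply: ler_sum => j _.
by rewrite normrM ler_wpM2l// entry_le_norm.
Qed.

End matrix_size.

Section euler_scheme.
Variables (R : realType) (N n : nat) (A : 'I_N -> 'M[R]_n).

(** The state after k steps of length h from time t. The recursion peels off the
    first step: the rest of the scheme then starts from a later time and another
    vector, which is the form needed to condition on the chain. *)
Fixpoint euler (rho : R -> 'I_N) (h : R) (k : nat) (t : R) (z : 'cV[R]_n) :
    'cV[R]_n :=
  if k is k'.+1 then euler rho h k' (t + h) (z + h *: (A (rho t) *m z)) else z.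

(** Error estimates compare the scheme with the solution at the end of each step,
    which requires peeling off the last one. *)
Lemma eulerSr rho h k t z :
  euler rho h k.+1 t z =
  euler rho h k t z + h *: (A (rho (t + k%:R * h)) *m euler rho h k t z).
Proof.
elim: k t z => [|k IH] t z; first by rewrite /= mul0r addr0.
rewrite [LHS]IH [in RHS]/=; congr (_ + _ *: (A (rho _) *m _)).
by rewrite -addrA -[in LHS](mul1r h) mulrA mulr1 -mulrDl -natr1 addrC [k%:R + 1]addrC addrC.
Qed.

Definition growth_rate : R := \sum_i mxsize (A i).

Lemma growth_rate_ge0 : 0 <= growth_rate.
Proof. by apply: sumr_ge0 => i _; exact: mxsize_ge0. Qed.

Lemma growth_rateP i (z : 'cV[R]_n) : `|A i *m z| <= growth_rate * `|z|.
Proof.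
rewrite (le_trans (mulmx_norm_le _ _))// ler_wpM2r// /growth_rate (bigD1 i)//=.
by rewrite lerDl; apply: sumr_ge0 => j _; exact: mxsize_ge0.
Qed.

Lemma expr1D_le_expR (c : R) k : 0 <= 1 + c -> (1 + c) ^+ k <= expR (k%:R * c).
Proof.
move=> c0; rewrite mulrC expRM_natr lerXn2r ?nnegrE ?expR_ge0//.
exact: expR_ge1Dx.
Qed.

Lemma euler_norm_le rho h k t z : 0 <= h ->
  `|euler rho h k t z| <= (1 + h * growth_rate) ^+ k * `|z|.
Proof.
move=> h0; elim: k => [|k IH]; first by rewrite /= expr0 mul1r.
rewrite eulerSr (le_trans (ler_normD _ _))// normrZ ger0_norm//.
rewrite (@le_trans _ _ ((1 + h * growth_rate) * `|euler rho h k t z|))//; last first.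
  by rewrite exprS -mulrA ler_wpM2l// addr_ge0// mulr_ge0// growth_rate_ge0.
by rewrite mulrDl mul1r lerD2l -mulrA ler_wpM2l// growth_rateP.
Qed.

End euler_scheme.

(** * Derivatives of vector functions, finitely many jumps *)

Section derive_columns.
Variables (R : realType).

Lemma is_derive_mxP p q (f : R -> 'M[R]_(p, q)) (t : R) (w : 'M[R]_(p, q)) :
  is_derive t 1 f w <-> forall i j, is_derive t 1 (fun s => f s i j) (w i j).
Proof.
split=> [[df <-] i j|dfE].
  apply: DeriveDef; first by move/derivable_mxP : df; exact.
  by rewrite derive_mx// mxE.
have df : derivable f t 1 by apply/derivable_mxP => i j; case: (dfE i j).
apply: DeriveDef => //; apply/matrixP => i j.
by rewrite derive_mx// mxE; case: (dfE i j).
Qed.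

Lemma within_continuous_entry p q (f : R -> 'M[R]_(p, q)) (D : set R) i j :
  {within D, continuous f} -> {within D, continuous (fun s => f s i j)}.
Proof.
move=> cf x.
apply: (@continuous_comp (subspace D) _ _ f (fun M : 'M[R]_(p, q) => M i j)).
  exact: cf.
exact: coord_continuous.
Qed.

(** With w0 = 0 this is a Lipschitz bound; with w0 the derivative at a it is the
    error of one Euler step. *)
Lemma mean_value_norm p (f df : R -> 'cV[R]_p) (w0 : 'cV[R]_p) (a b c : R) :
  a <= b -> {within `[a, b], continuous f} ->
  (forall u, u \in `]a, b[ -> is_derive u 1 f (df u)) ->
  (forall u, u \in `[a, b] -> `|df u - w0| <= c) ->
  `|f b - f a - (b - a) *: w0| <= c * (b - a).
Proof.
move=> ab cf dfE dfc.
have c0 : 0 <= c.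
  by rewrite (le_trans (normr_ge0 _) (dfc a _))// in_itv/= lexx.
apply: norm_le_entries => [|k]; first by rewrite mulr_ge0// subr_ge0.
have [u uab] := @MVT_segment R (fun s => f s k 0) (fun s => df s k 0) a b ab
  (fun u uab => (@is_derive_mxP _ _ _ _ _).1 (dfE u uab) k 0)
  (@within_continuous_entry _ _ _ _ k 0 cf).
move=> fkE.
have -> : (f b - f a - (b - a) *: w0) k 0 = (df u - w0) k 0 * (b - a).
  rewrite [RHS]mulrC [X in (b - a) * X]mxE [X in _ * (_ + X)]mxE mulrDr mulrN.
  by rewrite [(b - a) * df u k 0]mulrC -fkE !mxE.
rewrite normrM.
rewrite [`|b - a|]ger0_norm ?subr_ge0// ler_wpM2r ?subr_ge0//.
by rewrite (le_trans (entry_le_norm _ k))// dfc.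
Qed.

End derive_columns.

Section step_paths.
Variables (R : realType) (N : nat) (rho : R -> 'I_N).

(** Times that can be reached from 0 through finitely many intervals of constancy
    of the path; induction on this predicate replaces an induction on the number
    of jumps. *)
Inductive steps : R -> Prop :=
| steps0 : steps 0
| stepsD s s' : steps s -> s <= s' ->
    (forall u, s <= u < s' -> rho u = rho s) -> steps s'.

Lemma steps_ge0 s : steps s -> 0 <= s.
Proof. by elim=> // {}s s' _ s0 ss' _; exact: le_trans ss'. Qed.

(** The supremum s of the times reachable by finitely many pieces is reachable,
    because the path has a left limit at s, and equals t, because the path is
    right-continuous at s. *)
Lemma step_path_steps (t : R) : step_path rho -> 0 <= t -> steps t.
Proof.
move=> [rcont lcont] t0.
pose S := [set s | s <= t /\ steps s].
have S0 : S 0 by split => //; exact: steps0.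
have supS : has_sup S by split; [exists 0|exists t => s []].
have b0 : 0 <= sup S by apply: ub_le_sup => //; case: supS.
have bt : sup S <= t by apply: ge_sup; [exists 0|move=> s []].
have stepsb : steps (sup S).
  have [<-|bgt0] := eqVneq 0 (sup S); first exact: steps0.
  have {bgt0}bgt0 : 0 < sup S by rewrite lt_neqAle bgt0.
  case: (lcont _ bgt0) => i [e /= e0 ei].
  have [s [st sS] sb] := sup_adherent e0 supS.
  have sleb : s <= sup S by apply: ub_le_sup; [case: supS|split].
  apply: (stepsD sS sleb) => u /andP[su ub].
  have rhoi v : s <= v -> v < sup S -> rho v = i.
    move=> sv vb; apply: ei => //=.
    by rewrite gtr0_norm ?subr_gt0// ltrBlDr -ltrBlDl (lt_le_trans sb).
  by rewrite !rhoi// (le_lt_trans su).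
have [<-//|bnt] := eqVneq (sup S) t.
have {bnt}blt : sup S < t by rewrite lt_neqAle bnt.
have [e /= e0 ei] := rcont _ b0.
(* Right continuity adds one more piece, of length e unless t comes first. *)
pose s := Num.min t (sup S + e).
have sb : sup S < s by rewrite lt_min blt ltrDl.
suff : s <= sup S by rewrite leNgt sb.
apply: ub_le_sup; [by case: supS|split; first by rewrite ge_min lexx].
apply: (stepsD stepsb (ltW sb)) => u /andP[bu us].
have [->//|ub] := eqVneq u (sup S).
have {ub}ub : sup S < u by rewrite lt_neqAle eq_sym ub.
apply: ei => //=; rewrite ltr0_norm ?subr_lt0// opprB ltrBlDl.
by rewrite (lt_le_trans us)// ge_min lexx orbT.
Qed.

End step_paths.

(** * Convergence of the Euler scheme along one path *)

Section euler_convergence.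
Variables (R : realType) (N n : nat) (A : 'I_N -> 'M[R]_n) (rho : R -> 'I_N).
Variables (x0 : 'cV[R]_n) (y : R -> 'cV[R]_n).
Hypothesis y_solves : solves A rho x0 y.
Variables (t Y : R).
Hypothesis y_le : forall u, 0 <= u <= t -> `|y u| <= Y.

Local Notation a := (growth_rate A).

Let a0 : 0 <= a := growth_rate_ge0 A.

Let continuous_y u v : 0 <= u -> {within `[u, v], continuous y}.
Proof.
move=> u0; have [_ cy _] := y_solves; apply: continuous_subspaceW cy => s /=.
by rewrite !in_itv/= andbT => /andP[us _]; exact: le_trans us.
Qed.

Section one_step.
Variables (s s' : R).
Hypotheses (s0 : 0 <= s) (ss' : s <= s') (s't : s' <= t).
Hypothesis rho_cst : forall u, s <= u < s' -> rho u = rho s.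

Let derivative_y u : u \in `]s, s'[ -> is_derive u 1 y (A (rho s) *m y u).
Proof.
rewrite in_itv/= => /andP[su us'].
have us : rho u = rho s by apply: rho_cst; rewrite (ltW su).
have [_ _ dy] := y_solves; rewrite -us; apply: dy; first exact: le_lt_trans su.
near=> v; rewrite us; apply: rho_cst; apply/andP; split.
  by apply: ltW; near: v; exact: lt_nbhsr.
by near: v; exact: lt_nbhsl.
Unshelve. all: by end_near. Qed.

Let within u v : s <= u -> v <= s' -> {subset `[u, v] <= `[0, t]}.
Proof.
move=> su vs' w; rewrite !in_itv/= => /andP[uw wv].
by rewrite (le_trans s0 (le_trans su uw)) (le_trans wv (le_trans vs' s't)).
Qed.

Lemma step_lipschitz u v : s <= u -> u <= v -> v <= s' ->
  `|y v - y u| <= a * Y * (v - u).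
Proof.
move=> su uv vs'; have := @mean_value_norm R n y
  (fun w => A (rho s) *m y w) 0 u v (a * Y) uv.
rewrite scaler0 subr0; apply; first by apply: continuous_y; exact: le_trans su.
  move=> w; rewrite in_itv/= => /andP[uw wv]; apply: derivative_y.
  by rewrite in_itv/= (le_lt_trans su uw) (lt_le_trans wv vs').
move=> w wuv; rewrite subr0 (le_trans (growth_rateP _ _ _))// ler_wpM2l// y_le//.
by have := within su vs' wuv; rewrite in_itv.
Qed.

Lemma step_local_error u v : s <= u -> u < v -> v <= s' ->
  `|y v - y u - (v - u) *: (A (rho u) *m y u)| <= a ^+ 2 * Y * (v - u) ^+ 2.
Proof.
move=> su uv vs'; have uv' := ltW uv.
rewrite (rho_cst (u := u)) ?su ?(lt_le_trans uv)//.
have -> : a ^+ 2 * Y * (v - u) ^+ 2 = a * (a * Y * (v - u)) * (v - u) by ring.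
apply: (mean_value_norm (df := fun w => A (rho s) *m y w) uv').
- by apply: continuous_y; exact: le_trans su.
- move=> w; rewrite in_itv/= => /andP[uw wv]; apply: derivative_y.
  by rewrite in_itv/= (le_lt_trans su uw) (lt_le_trans wv vs').
- move=> w; rewrite in_itv/= => /andP[uw wv].
  rewrite -mulmxBr (le_trans (growth_rateP _ _ _))// ler_wpM2l//.
  rewrite (le_trans (step_lipschitz su uw (le_trans wv vs')))//.
  rewrite ler_wpM2l ?lerD2r// mulr_ge0// (le_trans _ (y_le (u := s) _))//.
  by rewrite s0 (le_trans ss').
Qed.

End one_step.

Hypothesis t0 : 0 <= t.

Let Y0 : 0 <= Y.
Proof. by rewrite (le_trans _ (y_le (u := 0) _)) ?lexx. Qed.

(** The Lipschitz constant does not depend on the pieces, so that it also covers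
    the Euler steps that contain jumps. *)
Lemma solution_lipschitz s : steps rho s -> s <= t ->
  forall u v, 0 <= u -> u <= v -> v <= s -> `|y v - y u| <= a * Y * (v - u).
Proof.
elim=> [_ u v u0 uv v0|{}s s' steps_s IH ss' rho_cst s't u v u0 uv vs'].
  have -> : u = 0 by apply/eqP; rewrite eq_le u0 (le_trans uv).
  have -> : v = 0 by apply/eqP; rewrite eq_le v0 (le_trans u0).
  by rewrite !subrr mulr0 normr0.
have st := le_trans ss' s't; have s0 := steps_ge0 steps_s.
(* A pair u < s < v is split at the time s where the new piece starts. *)
have [vs|sv] := leP v s; first exact: IH.
have [su|us] := leP s u; first exact: (step_lipschitz s0 s't rho_cst).
rewrite -(subrK (y s) (y v)) -addrA (le_trans (ler_normD _ _))//.
have -> : a * Y * (v - u) = a * Y * (v - s) + a * Y * (s - u) by ring.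
apply: lerD; first by apply: (step_lipschitz s0 s't rho_cst) => //; exact: ltW.
by apply: IH => //; exact: ltW.
Qed.

(** A step inside a piece costs O(h^2), and each of the finitely many steps that
    straddle two pieces costs O(h); the accumulated error is O(h). The constant
    depends on the path, which suffices for convergence along that path. *)
Lemma euler_error s : steps rho s -> s <= t -> exists2 C : R, 0 <= C &
  forall h k, 0 < h -> k%:R * h <= s ->
    `|euler A rho h k 0 x0 - y (k%:R * h)| <= C * h.
Proof.
have [y0 _ _] := y_solves.
elim=> [_|{}s s' steps_s IH ss' rho_cst s't].
  exists 0 => // h k h0; rewrite pmulr_lle0// lern0 => /eqP ->.
  by rewrite /= mul0r y0 subrr normr0.
have st := le_trans ss' s't; have s0 := steps_ge0 steps_s.
have [C C0 errC] := IH st.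
pose D := C + 2 * a * Y.
have D0 : 0 <= D by rewrite addr_ge0// !mulr_ge0.
exists (expR (a * s') * (D + s' * (a ^+ 2 * Y))) => [|h k h0 ks'].
  by rewrite mulr_ge0 ?expR_ge0// addr_ge0// !mulr_ge0// ?sqr_ge0// (le_trans s0).
have h0' := ltW h0.
have ah0 : 0 <= h * a by rewrite mulr_ge0.
have growth_ge1 j : 1 <= (1 + h * a) ^+ j by rewrite exprn_ege1// lerDl.
have aY0 : 0 <= a ^+ 2 * Y by rewrite mulr_ge0 ?sqr_ge0.
have K0 j : 0 <= D * h + j%:R * h ^+ 2 * (a ^+ 2 * Y).
  by rewrite addr_ge0 ?mulr_ge0 ?sqr_ge0.
have steps_s' : steps rho s' by exact: stepsD rho_cst.
suff step : `|euler A rho h k 0 x0 - y (k%:R * h)|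
    <= (1 + h * a) ^+ k * (D * h + k%:R * h ^+ 2 * (a ^+ 2 * Y)).
  apply: (le_trans step); rewrite -[leRHS]mulrA; apply: ler_pM => //.
      by rewrite (le_trans _ (growth_ge1 _)).
    apply: (le_trans (expr1D_le_expR _ _)); first by rewrite addr_ge0.
    by rewrite ler_expR mulrA [leLHS]mulrC ler_wpM2l.
  have -> : (D + s' * (a ^+ 2 * Y)) * h = D * h + s' * h * (a ^+ 2 * Y) by ring.
  by rewrite lerD2l ler_wpM2r// expr2 mulrA ler_wpM2r.
elim: k ks' => [_|k IHk ks'].
  by rewrite /= mul0r y0 subrr normr0 mulr_ge0// (le_trans _ (growth_ge1 _)).
have kE : k.+1%:R * h = k%:R * h + h by rewrite -natr1 mulrDl mul1r.
(* Three cases: the step ends before s, starts after s, or straddles s; only a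
   straddling step has a local error of order h rather than h^2. *)
have [ks|sk] := leP (k.+1%:R * h) s.
  apply: (le_trans (errC h k.+1 h0 ks)).
  apply: (@le_trans _ _ (1 * (C * h + 0))); first by rewrite mul1r addr0.
  apply: ler_pM => //; first by rewrite addr0 mulr_ge0.
  by rewrite lerD ?mulr_ge0 ?sqr_ge0// ler_wpM2r// lerDl !mulr_ge0.
have k0 : 0 <= k%:R * h by rewrite mulr_ge0.
have kk : k%:R * h <= k.+1%:R * h by rewrite kE lerDl.
have {}IHk := IHk (le_trans kk ks').
pose loc := y (k.+1%:R * h) - y (k%:R * h)
   - h *: (A (rho (k%:R * h)) *m y (k%:R * h)).
have splitE : euler A rho h k.+1 0 x0 - y (k.+1%:R * h) =
    (euler A rho h k 0 x0 - y (k%:R * h)) + h *: (A (rho (k%:R * h)) *m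
      (euler A rho h k 0 x0 - y (k%:R * h))) - loc.
  by rewrite eulerSr add0r /loc mulmxBr scalerBr; apply/matrixP => i j; rewrite !mxE; ring.
have err_le e : `|euler A rho h k 0 x0 - y (k%:R * h)| <= e ->
    `|euler A rho h k.+1 0 x0 - y (k.+1%:R * h)| <= (1 + h * a) * e + `|loc|.
  move=> ee; rewrite splitE (le_trans (ler_normB _ _))// lerD2r.
  rewrite (le_trans (ler_normD _ _))// mulrDl mul1r lerD// normrZ ger0_norm//.
  by rewrite -mulrA ler_wpM2l// (le_trans (growth_rateP _ _ _))// ler_wpM2l.
have [sk'|ks] := leP s (k%:R * h).
  have loc_le : `|loc| <= h ^+ 2 * (a ^+ 2 * Y).
    rewrite /loc; have -> : h *: (A (rho (k%:R * h)) *m y (k%:R * h)) =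
      (k.+1%:R * h - k%:R * h) *: (A (rho (k%:R * h)) *m y (k%:R * h)).
      by rewrite kE addrC addKr.
    have -> : h ^+ 2 = (k.+1%:R * h - k%:R * h) ^+ 2 by rewrite kE addrC addKr.
    rewrite [leRHS]mulrC; apply: (step_local_error s0 ss' s't rho_cst) => //.
    by rewrite kE ltrDl.
  apply: (le_trans (err_le _ IHk)).
  rewrite mulrA -exprS -natr1; move: (growth_ge1 k.+1) loc_le.
  set g := (1 + h * a) ^+ k.+1 => g1 loc_le.
  have -> : g * (D * h + (k%:R + 1) * h ^+ 2 * (a ^+ 2 * Y)) =
    g * (D * h + k%:R * h ^+ 2 * (a ^+ 2 * Y)) + g * (h ^+ 2 * (a ^+ 2 * Y)) by ring.
  by rewrite lerD2l (le_trans loc_le)// ler_peMl// mulr_ge0// sqr_ge0.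
have loc_le : `|loc| <= 2 * a * Y * h.
  rewrite (le_trans (ler_normB _ _))//.
  have -> : 2 * a * Y * h = a * Y * (k.+1%:R * h - k%:R * h) + h * (a * Y).
    by rewrite kE; ring.
  rewrite lerD ?(solution_lipschitz steps_s' s't)// normrZ ger0_norm// ler_wpM2l//.
  rewrite (le_trans (growth_rateP _ _ _))// ler_wpM2l// y_le//.
  by rewrite k0 (le_trans kk)// (le_trans ks').
apply: (le_trans (err_le _ (errC h k h0 (ltW ks)))).
apply: (@le_trans _ _ ((1 + h * a) ^+ k.+1 * (D * h))); last first.
  rewrite ler_wpM2l ?lerDl ?(mulr_ge0,sqr_ge0)//.
  by rewrite (le_trans _ (growth_ge1 _)).
rewrite /D [(C + _) * h]mulrDl mulrDr lerD//; last first.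
  by rewrite (le_trans loc_le)// ler_peMl// !mulr_ge0.
rewrite ler_wpM2r ?mulr_ge0// exprS ler_peMr ?addr_ge0//.
Qed.

End euler_convergence.

Section euler_limit.
Variables (R : realType) (N n : nat) (A : 'I_N -> 'M[R]_n) (rho : R -> 'I_N).
Variables (x0 : 'cV[R]_n) (y : R -> 'cV[R]_n).

Lemma solution_bounded (t : R) : 0 <= t -> solves A rho x0 y ->
  exists Y : R, forall u, 0 <= u <= t -> `|y u| <= Y.
Proof.
move=> t0 [_ cy _].
have cny : {within `[0, t], continuous (fun u => `|y u|)}.
  have cyt : {within `[0, t], continuous y}.
    apply: continuous_subspaceW cy => s /=.
    by rewrite !in_itv/= andbT => /andP[].
  move=> u; apply: (@continuous_comp (subspace `[0, t]) _ _ y (fun v => `|v|)).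
    exact: cyt.
  exact: norm_continuous.
have [c _ cmax] := EVT_max t0 cny.
by exists `|y c| => u ut; apply: cmax; rewrite in_itv.
Qed.

Lemma euler_cvg (t : R) : 0 < t -> step_path rho -> solves A rho x0 y ->
  euler A rho (t / k.+1%:R) k.+1 0 x0 @[k --> \oo] --> y t.
Proof.
move=> t0 rho_step y_solves.
have [Y y_le] := solution_bounded (ltW t0) y_solves.
have t_steps := step_path_steps rho_step (ltW t0).
have [C C0 errC] := euler_error y_solves y_le (ltW t0) t_steps (lexx t).
apply/cvgrPdist_le => e e0.
have harm : (C * t) * harmonic k @[k --> \oo] --> (0 : R).
  by rewrite -[X in _ --> X](mulr0 (C * t)); apply: cvgMr; exact: cvg_harmonic.
move/cvgrPdist_le : harm => /(_ e e0); apply: filterS => k.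
rewrite sub0r normrN ger0_norm ?mulr_ge0 ?(ltW t0) ?harmonic_ge0// => ke.
have kt : k.+1%:R * (t / k.+1%:R) = t by rewrite mulrC divfK// pnatr_eq0.
have := errC (t / k.+1%:R) k.+1; rewrite kt lexx divr_gt0// => /(_ isT isT) err.
by rewrite distrC (le_trans err)// mulrA.
Qed.

End euler_limit.

(** * The Markov property and the law of the Euler scheme *)

Section transition.
Variables (d : measure_display) (T : measurableType d) (R : realType) (N : nat).
Variables (Q : 'M[R]_N) (P : 'I_N -> probability T R) (r : 'I_N -> R -> T -> 'I_N).
Hypothesis r_chain : forall i0, markov_chain (P i0) Q i0 (r i0).

(** The transition probability p_ij(h) of the chain started in i0. If that chain
    never visits i, its conditional probabilities say nothing about row i, and the
    chain started in i supplies the row: every row thus consists of probabilities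
    with the derivative Q at h = 0. *)
Definition transition (i0 : 'I_N) (h : R) : 'M[R]_N := \matrix_(i, j)
  match pselect (exists u, 0 <= u /\ P i0 (in_state (r i0) u i) != 0%E) with
  | left reached => let u := sval (cid reached) in
      cprob (P i0) (in_state (r i0) (u + h) j) (in_state (r i0) u i)
  | right _ => cprob (P i) (in_state (r i) (0 + h) j) (in_state (r i) 0 i)
  end.

Lemma cprob_ge0 (p : probability T R) (E F : set T) : 0 <= cprob p E F.
Proof. by rewrite /cprob divr_ge0// fine_ge0. Qed.

Lemma transition_ge0 i0 h i j : 0 <= transition i0 h i j.
Proof. by rewrite mxE; case: pselect => /= [?|?]; exact: cprob_ge0. Qed.

(** For each i, the row i is read off at one fixed time at which i has positive
    probability, so that the defining limit of Q applies to it. *)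
Lemma transition_generator i0 i j :
  (transition i0 h i j - (i == j)%:R) / h @[h --> 0^'+] --> Q i j.
Proof.
under eq_fun do rewrite mxE.
case: pselect => [reached|_].
  by case: (cid reached) => u /= [u0 ui]; exact: (mc_generator (r_chain i0)).
by apply: (mc_generator (r_chain i)) => //; rewrite (mc_init (r_chain i)) eqe oner_eq0.
Qed.

Lemma measurable_follows i0 (past : seq (R * 'I_N)) :
  (forall p, p \in past -> 0 <= p.1) -> measurable (follows (r i0) past).
Proof.
elim: past => [_|p past IH past0].
  have -> : follows (r i0) [::] = setT by apply/seteqP; split.
  exact: measurableT.
have -> : follows (r i0) (p :: past) =
    in_state (r i0) p.1 p.2 `&` follows (r i0) past.
  apply/seteqP; split=> w /= => [rw|[rp rw] q].
    by split=> [|q qpast]; apply: rw; rewrite inE ?eqxx ?qpast ?orbT.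
  by rewrite inE => /orP[/eqP ->//|]; exact: rw.
apply: measurableI; last by apply: IH => q qpast; apply: past0; rewrite inE qpast orbT.
by apply: (mc_measurable (r_chain i0)); apply: past0; rewrite mem_head.
Qed.

(** The Markov property and homogeneity, in product form; this form also covers
    conditioning events of probability zero. *)
Lemma markov_step i0 (past : seq (R * 'I_N)) t h i j :
  (forall p, p \in past -> 0 <= p.1 <= t) -> 0 <= t -> 0 <= h ->
  P i0 (follows (r i0) past `&` in_state (r i0) t i `&` in_state (r i0) (t + h) j)
  = (P i0 (follows (r i0) past `&` in_state (r i0) t i) *
     (transition i0 h i j)%:E)%E.
Proof.
move=> past_t t0 h0; set F := follows _ _ `&` _; set G := in_state _ (t + h) j.
have mI : measurable (in_state (r i0) t i) by exact: (mc_measurable (r_chain i0)).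
have mF : measurable F.
  by apply: measurableI => //; apply: measurable_follows => p /past_t/andP[].
have mG : measurable G.
  by apply: (mc_measurable (r_chain i0)); rewrite addr_ge0.
have [F0|F0] := eqVneq (P i0 F) 0%E.
  rewrite F0 mul0e; apply/eqP; rewrite -measure_le0 -F0.
  by apply: le_measure; rewrite ?inE//; exact: measurableI.
have I0 : P i0 (in_state (r i0) t i) != 0%E.
  apply: contra_neq F0 => I0; apply/eqP; rewrite -measure_le0 -I0.
  by apply: le_measure; rewrite ?inE//; exact: subIsetr.
have -> : transition i0 h i j = cprob (P i0) G F.
  rewrite mxE; case: pselect => [reached|[]]; last by exists t.
  case: (cid reached) => u /= [u0 ui].
  rewrite (mc_homogeneous (r_chain i0) j u0 t0 h0)//; apply/esym.
  apply: (mc_markov (r_chain i0)) => //. by rewrite lerDl.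
rewrite /cprob -{1}[P i0 F]fineK ?fin_num_measure// -EFinM mulrC divfK; last first.
  by apply: contra F0 => /eqP F0; rewrite -[P i0 F]fineK ?fin_num_measure// F0.
by rewrite fineK ?fin_num_measure ?[G `&` F]setIC//; exact: measurableI.
Qed.

Lemma start_in i0 : P i0 (~` in_state (r i0) 0 i0) = 0%E.
Proof.
rewrite probability_setC; last exact: (mc_measurable (r_chain i0)).
by rewrite (mc_init (r_chain i0)) subee.
Qed.

End transition.

Section euler_law.
Variables (d : measure_display) (T : measurableType d) (R : realType) (N n : nat).
Variables (Q : 'M[R]_N) (P : 'I_N -> probability T R) (r : 'I_N -> R -> T -> 'I_N).
Hypothesis r_chain : forall i0, markov_chain (P i0) Q i0 (r i0).
Variables (A : 'I_N -> 'M[R]_n) (i0 : 'I_N).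

(** The expectation of G at the end of k Euler steps, for a chain in state i with
    transition matrix p and a scheme at z: condition on the next state. *)
Fixpoint scheme_mean (p : 'M[R]_N) (h : R) (G : 'I_N -> 'cV[R]_n -> R) (k : nat)
    (i : 'I_N) (z : 'cV[R]_n) : R :=
  if k is k'.+1 then \sum_j p i j * scheme_mean p h G k' j (z + h *: (A i *m z))
  else G i z.

Variables (h : R) (g : 'cV[R]_n -> R).
Hypotheses (h0 : 0 <= h) (g0 : forall z, 0 <= g z).

Let p := transition P r i0 h.

Lemma scheme_mean_ge0 k i z : 0 <= scheme_mean p h (fun=> g) k i z.
Proof.
elim: k i z => [|k IH] i z /=; first exact: g0.
by apply: sumr_ge0 => j _; rewrite mulr_ge0// transition_ge0.
Qed.

Lemma mem_bigsetU (F : 'I_N -> set T) w :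
  (\big[setU/set0]_j F j) w <-> exists j, F j w.
Proof.
rewrite -bigcup_seq; split=> [[j _ jw]|[j jw]]; first by exists j.
by exists j => //=; rewrite mem_index_enum.
Qed.

(** By induction on the number of steps, for all pasts at once: the event that the
    chain followed a given past and is now in i splits according to the next state
    j, on each part the first Euler step is known, and the pair (t, i) joins the
    past. Measurability comes from the same splitting into finitely many pieces. *)
Lemma euler_law k (past : seq (R * 'I_N)) (t : R) i z :
  (forall q, q \in past -> 0 <= q.1 <= t) -> 0 <= t ->
  let D := follows (r i0) past `&` in_state (r i0) t i in
  let f (w : T) : \bar R := (g (euler A (r i0 ^~ w) h k t z))%:E in
  measurable_fun D f /\
  (\int[P i0]_(w in D) f w = P i0 D * (scheme_mean p h (fun=> g) k i z)%:E)%E.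
Proof.
elim: k past t i z => [|k IH] past t i z past_t t0 D f.
  have mD : measurable D.
    apply: measurableI; last exact: (mc_measurable (r_chain i0)).
    by apply: (measurable_follows r_chain) => q /past_t/andP[].
  by rewrite /f /=; split; [exact: measurable_cst|rewrite muleC -integral_cst].
pose past' := (t, i) :: past.
have past'_t q : q \in past' -> 0 <= q.1 <= t + h.
  rewrite inE => /orP[/eqP ->/=|/past_t/andP[-> qt]]; first by rewrite t0 lerDl.
  by rewrite (le_trans qt)// lerDl.
pose E j := follows (r i0) past' `&` in_state (r i0) (t + h) j.
have t'0 : 0 <= t + h by rewrite addr_ge0.
have EE j : E j = D `&` in_state (r i0) (t + h) j.
  rewrite /E /D; apply/seteqP; split=> w /=.
    move=> [rw rj]; split=> //; split; last by rewrite /in_state/= (rw (t, i))// mem_head.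
    by move=> q qpast; apply: rw; rewrite inE qpast orbT.
  move=> [[rw ri] rj]; split => // q; rewrite inE => /orP[/eqP ->//|].
  exact: rw.
have mE j : measurable (E j).
  apply: measurableI; last exact: (mc_measurable (r_chain i0)).
  by apply: (measurable_follows r_chain) => q /past'_t/andP[].
have DE : D = \big[setU/set0]_j E j.
  apply/seteqP; split=> w /=.
    by move=> Dw; apply/mem_bigsetU; exists (r i0 (t + h) w); rewrite EE.
  by move/mem_bigsetU => [j]; rewrite EE => -[].
have fE j w : E j w -> f w = (g (euler A (r i0 ^~ w) h k (t + h) (z + h *: (A i *m z))))%:E.
  by rewrite EE => -[[_ /= ri] _]; rewrite /f /= ri.
have {}IH j := IH past' (t + h) j (z + h *: (A i *m z)) past'_t t'0.
have mf j : measurable_fun (E j) f.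
  apply: eq_measurable_fun (IH j).1 => w; rewrite inE => Ew; exact/esym/(fE j).
have mfD : measurable_fun D f.
  move=> mD Y mY.
  have -> : D `&` f @^-1` Y = \big[setU/set0]_j (E j `&` f @^-1` Y).
    apply/seteqP; split=> w /=.
      rewrite {1}DE => -[/mem_bigsetU[j Ew] fw].
      by apply/mem_bigsetU; exists j.
    move/mem_bigsetU => [j [Ew fw]]; split=> //.
    by rewrite DE; apply/mem_bigsetU; exists j.
  by apply: bigsetU_measurable => j _; exact: mf.
split => //.
rewrite {1}DE ge0_integral_bigsetU//=; last 4 first.
- exact: index_enum_uniq.
- by move=> j1 j2 _ _ [w []]; rewrite !EE => -[_ <-] [_ <-].
- by rewrite -DE.
- by move=> w _; rewrite lee_fin.
transitivity (\sum_j (P i0 D *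
  (p i j * scheme_mean p h (fun=> g) k j (z + h *: (A i *m z)))%:E))%E.
  apply: eq_bigr => j _.
  rewrite (eq_integral (fun w =>
    (g (euler A (r i0 ^~ w) h k (t + h) (z + h *: (A i *m z))))%:E)); last first.
    by move=> w; rewrite inE => Ew; rewrite (fE j).
  have [_ /= ->] := IH j.
  by rewrite -/(E j) EE /D (markov_step r_chain)// EFinM muleA.
by rewrite -ge0_sume_distrr ?sumEFin// => j _;
  rewrite lee_fin mulr_ge0 ?transition_ge0 ?scheme_mean_ge0.
Qed.

Lemma measurable_euler k z :
  measurable_fun setT (fun w => g (euler A (r i0 ^~ w) h k 0 z)).
Proof.
apply/measurable_EFinP => mT Y mY.
have mI j : measurable (in_state (r i0) 0 j) by exact: (mc_measurable (r_chain i0)).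
have -> : [set: T] `&` (EFin \o (fun w => g (euler A (r i0 ^~ w) h k 0 z))) @^-1` Y =
  \big[setU/set0]_j (follows (r i0) [::] `&` in_state (r i0) 0 j `&`
     (EFin \o (fun w => g (euler A (r i0 ^~ w) h k 0 z))) @^-1` Y).
  apply/seteqP; split=> w /=.
    by move=> [_ Yw]; apply/mem_bigsetU; exists (r i0 0 w).
  by move/mem_bigsetU => [j [_ Yw]].
apply: bigsetU_measurable => j _.
have nopast : forall q : R * 'I_N, q \in [::] -> 0 <= q.1 <= 0 by [].
have [mf _] := euler_law k j z nopast (lexx 0).
apply: mf => //; apply: measurableI => //.
exact: (measurable_follows r_chain).
Qed.

Lemma expectation_euler k z :
  ('E_(P i0)[fun w => g (euler A (r i0 ^~ w) h k 0 z)] =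
   (scheme_mean p h (fun=> g) k i0 z)%:E)%E.
Proof.
have nopast : forall q : R * 'I_N, q \in [::] -> 0 <= q.1 <= 0 by [].
have [_] := euler_law k i0 z nopast (lexx 0).
have -> : follows (r i0) [::] `&` in_state (r i0) 0 i0 = in_state (r i0) 0 i0.
  by apply/seteqP; split=> w // [].
rewrite (mc_init (r_chain i0)) mul1e => <-.
have mI : measurable (in_state (r i0) 0 i0) by exact: (mc_measurable (r_chain i0)).
rewrite unlock /= (@ge0_negligible_integral _ _ _ (P i0) setT (~` in_state (r i0) 0 i0))//.
- by rewrite setTD setCK.
- exact: measurableC.
- by apply/measurable_EFinP; exact: measurable_euler.
- by move=> w _; rewrite lee_fin.
- exact: start_in.
Qed.

End euler_law.

(** * Passage to the limit in the moments *)

Section moment_limit.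
Variables (d : measure_display) (T : measurableType d) (R : realType) (N n : nat).
Variables (Q : 'M[R]_N) (P : 'I_N -> probability T R) (r : 'I_N -> R -> T -> 'I_N).
Hypothesis r_chain : forall i0, markov_chain (P i0) Q i0 (r i0).
Variables (A : 'I_N -> 'M[R]_n) (i0 : 'I_N) (x0 : 'cV[R]_n).
Variable x : R -> T -> 'cV[R]_n.
Hypothesis x_traj : trajectory (P i0) A (r i0) x0 x.

Lemma measurable_norm_state (t : R) : 0 <= t -> measurable_fun setT (fun w => `|x t w|).
Proof.
move=> t0; have [mx _] := x_traj.
pose F s w : R := \big[Num.max/0]_(ij <- s) `|x t w ij.1 ij.2|.
have -> : (fun w => `|x t w|) = F (index_enum ('I_n * 'I_1)%type).
  by apply/funext => w; rewrite [LHS]/Num.Def.normr/= mx_normrE.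
elim: index_enum => [|[k l] s IH].
  rewrite (_ : F [::] = cst 0); first exact: measurable_cst.
  by apply/funext => w; rewrite /F big_nil.
rewrite (_ : F _ = (fun w => `|x t w k 0|) \max F s); last first.
  by apply/funext => w; rewrite /F big_cons (ord1 l).
apply: measurable_maxr => //; apply: measurableT_comp => //; exact: mx.
Qed.

Lemma moment_start m : ('E_(P i0)[fun w => (`|x 0 w| ^+ m)%R] = (`|x0| ^+ m)%:E)%E.
Proof.
rewrite -(expectation_cst (P i0)) unlock; apply: ae_eq_integral => //=.
- apply/measurable_EFinP; apply: measurable_funX.
  exact: measurable_norm_state.
- have [_] := x_traj; apply: filterS => w [xw _ _] _ /=.
  by rewrite xw.
Qed.

(** Dominated convergence: the scheme converges along almost every path, and is
    bounded by exp (a t) |x0| whatever the path. *)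
Lemma moment_limit m (t : R) : 0 < t -> exists2 c : R,
  ('E_(P i0)[fun w => (`|x t w| ^+ m)%R] = c%:E)%E &
  scheme_mean A (transition P r i0 (t / k.+1%:R)) (t / k.+1%:R)
    (fun=> fun z => `|z| ^+ m) k.+1 i0 x0 @[k --> \oo] --> c.
Proof.
move=> t0; have t0' := ltW t0.
pose z k w := euler A (r i0 ^~ w) (t / k.+1%:R) k.+1 0 x0.
pose f_ k w := (`|z k w| ^+ m)%:E.
pose f w := (`|x t w| ^+ m)%:E.
have h0 k : 0 <= t / k.+1%:R by rewrite divr_ge0.
have z_le k w : `|z k w| <= expR (t * growth_rate A) * `|x0|.
  rewrite (le_trans (euler_norm_le _ _ _ _ _ _))// ler_wpM2r//.
  apply: (le_trans (expr1D_le_expR _ _)).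
    by rewrite addr_ge0// mulr_ge0 ?growth_rate_ge0.
  by rewrite ler_expR mulrA [_ * (t / _)]mulrC divfK// pnatr_eq0.
have mf : measurable_fun setT f.
  by apply/measurable_EFinP; apply: measurable_funX; exact: measurable_norm_state.
have mf_ k : measurable_fun setT (f_ k).
  apply/measurable_EFinP.
  exact: (measurable_euler r_chain A i0 (h0 k) (g := fun v => `|v| ^+ m)
    (fun v => exprn_ge0 m (normr_ge0 v))).
have [] := @dominated_convergence _ T R (P i0) setT measurableT f_ f
  (cst ((expR (t * growth_rate A) * `|x0|) ^+ m)%:E) mf_ mf.
- have [_ sol] := x_traj; have step := mc_path (r_chain i0).
  move: sol step; apply: filterS2 => w xw rw _.
  apply: cvg_EFin; first by apply: nearW => k.
  have cvgz : `|z k w| @[k --> \oo] --> `|x t w|.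
    by apply: cvg_norm; exact: euler_cvg xw.
  exact: (cvg_comp _ _ cvgz (@exprn_continuous R m _)).
- exact: finite_measure_integrable_cst.
- apply: nearW => w k _ /=.
  rewrite lee_fin ger0_norm ?exprn_ge0//.
  by rewrite lerXn2r ?nnegrE ?mulr_ge0 ?expR_ge0.
move=> fint _ cvgf.
have ffin : (\int[P i0]_w f w)%E \is a fin_num by exact: integrable_fin_num.
exists (fine (\int[P i0]_w f w)); first by rewrite unlock fineK.
have fE : (\int[P i0]_w f w)%E = (fine (\int[P i0]_w f w))%:E by rewrite fineK.
move: cvgf; rewrite {}fE => /fine_cvg /=; apply: cvg_trans; apply: near_eq_cvg.
apply: nearW => k /=.
have := expectation_euler r_chain A i0 (h0 k) (g := fun v => `|v| ^+ m)
  (fun v => exprn_ge0 m (normr_ge0 v)) k.+1 x0.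
by rewrite unlock => ->.
Qed.

End moment_limit.

(** * Monomials of a fixed degree *)

Lemma digits_inj (b n : nat) (a a' : nat -> nat) :
  (forall i, i < n -> a i < b)%N -> (forall i, i < n -> a' i < b)%N ->
  (\sum_(i < n) a i * b ^ i = \sum_(i < n) a' i * b ^ i)%N ->
  forall i, (i < n)%N -> a i = a' i.
Proof.
elim: n a a' => [|n IH] a a' ab a'b //.
have b0 : (0 < b)%N by rewrite (leq_ltn_trans _ (ab 0%N _)).
have sumE (c : nat -> nat) :
    (\sum_(i < n.+1) c i * b ^ i = (\sum_(i < n) c i.+1 * b ^ i) * b + c 0)%N.
  rewrite big_ord_recl expn0 muln1 addnC; congr (_ + _)%N.
  by rewrite big_distrl; apply: eq_bigr => i _; rewrite /= expnSr mulnA.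
rewrite !sumE => sum_eq.
have a0 : a 0%N = a' 0%N.
  have := congr1 (modn^~ b) sum_eq.
  by rewrite !modnMDl !modn_small ?ab ?a'b.
move: sum_eq; rewrite a0 => /addIn/eqP; rewrite eqn_pmul2r// => /eqP sum_eq.
case=> [//|i]; rewrite ltnS => im.
by apply: (IH (a \o succn) (a' \o succn)) => // j jn; [apply: ab|apply: a'b].
Qed.

Section monomials.
Variables (R : realType) (n m : nat).

Definition monexp (k : 'I_(nmon n m)) : n.-tuple 'I_m.+1 :=
  nth [tuple ord0 | _ < n] (exponents n m) k.

Definition moncoef (k : 'I_(nmon n m)) : R :=
  Num.sqrt ((m`!)%:R / (\prod_(i < n) (tnth (monexp k) i)`!)%:R).

Lemma vpowE (z : 'cV[R]_n) k :
  vpow m z k 0 = moncoef k * \prod_(i < n) z i 0 ^+ tnth (monexp k) i.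
Proof. by rewrite mxE. Qed.

Lemma moncoef_gt0 k : 0 < moncoef k.
Proof.
rewrite sqrtr_gt0 divr_gt0 ?ltr0n ?fact_gt0//.
by rewrite prodn_gt0// => i; exact: fact_gt0.
Qed.

Lemma mem_exponents (e : n.-tuple 'I_m.+1) :
  (e \in exponents n m) = (\sum_(i < n) tnth e i == m)%N.
Proof. by rewrite mem_sort mem_enum finset.inE big_tuple. Qed.

Lemma sum_monexp k : (\sum_(i < n) tnth (monexp k) i = m)%N.
Proof.
by apply/eqP; rewrite -mem_exponents mem_nth// size_exponents.
Qed.

Lemma monexp_onto (e : 'I_n -> nat) : (\sum_i e i = m)%N ->
  exists k, forall i, tnth (monexp k) i = e i :> nat.
Proof.
move=> sum_e.
have e_le i : (e i < m.+1)%N by rewrite ltnS -sum_e (bigD1 i)//= leq_addr.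
pose t := [tuple Ordinal (e_le i) | i < n].
have te i : tnth t i = e i :> nat by rewrite tnth_mktuple.
have : t \in exponents n m.
  by rewrite mem_exponents; under eq_bigr do rewrite te; rewrite sum_e.
move=> t_in; have t_idx := t_in; rewrite -index_mem size_exponents in t_idx.
by exists (Ordinal t_idx) => i; rewrite /monexp /= nth_index.
Qed.

Lemma monexp_inj k k' :
  (forall i, tnth (monexp k) i = tnth (monexp k') i :> nat) -> k = k'.
Proof.
move=> kk'; apply/val_inj/eqP => /=.
rewrite -(nth_uniq [tuple ord0 | _ < n] (s := exponents n m)) ?size_exponents//.
  by apply/eqP/eq_from_tnth => i; apply/val_inj/kk'.
by rewrite sort_uniq enum_uniq.
Qed.

Lemma prod_word (z : 'I_n -> R) (f : {ffun 'I_m -> 'I_n}) :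
  \prod_s z (f s) = \prod_i z i ^+ #|[pred s | f s == i]|.
Proof.
rewrite (partition_big f xpredT)//=; apply: eq_bigr => i _.
by rewrite -prodr_const; apply: eq_big => s; rewrite ?inE// => /eqP ->.
Qed.

(** A monomial of degree m is a product over a word of m variables. Words are
    easier to multiply out than exponents, because a product of m linear forms is
    a sum over words. *)
Lemma word_exists k : exists f : {ffun 'I_m -> 'I_n}, forall z : 'I_n -> R,
  \prod_s z (f s) = \prod_i z i ^+ tnth (monexp k) i.
Proof.
pose w := flatten [seq nseq (tnth (monexp k) i) i | i <- enum 'I_n].
have prodw (z : 'I_n -> R) : \prod_(i <- w) z i = \prod_i z i ^+ tnth (monexp k) i.
  rewrite big_flatten big_map big_enum /=; apply: eq_bigr => i _.
  by rewrite big_nseq -Monoid.iteropE.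
have szw : size w = m.
  rewrite size_flatten /shape -map_comp sumnE big_map big_enum /=.
  by rewrite -[RHS](sum_monexp k); apply: eq_bigr => i _; rewrite /= size_nseq.
exists [ffun s => tnth (tcast szw (in_tuple w)) s] => z; rewrite -prodw.
under eq_bigr do rewrite ffunE.
by rewrite -(big_tuple _ _ (tcast szw (in_tuple w)) xpredT z) val_tcast.
Qed.

Definition word k : {ffun 'I_m -> 'I_n} := sval (cid (word_exists k)).

Lemma vpow_word (z : 'cV[R]_n) k :
  vpow m z k 0 = moncoef k * \prod_s z (word k s) 0.
Proof.
rewrite vpowE; congr (_ * _); rewrite /word; case: cid => f /= fE.
by rewrite (fE (z ^~ 0)).
Qed.

Lemma monom_exists (f : {ffun 'I_m -> 'I_n}) : exists k, forall z : 'cV[R]_n,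
  \prod_s z (f s) 0 = (moncoef k)^-1 * vpow m z k 0.
Proof.
(* The exponents are the numbers of occurrences of the variables in the word. *)
have [|k kE] := @monexp_onto (fun i => #|[pred s | f s == i]|).
  rewrite -[RHS]card_ord -sum1_card (partition_big f xpredT)//=.
  by apply: eq_bigr => i _; rewrite sum1_card; apply: eq_card => s; rewrite !inE.
exists k => z; rewrite vpowE mulKf ?gt_eqF ?moncoef_gt0// (prod_word (z ^~ 0)).
by apply: eq_bigr => i _; rewrite kE.
Qed.

Definition monom (f : {ffun 'I_m -> 'I_n}) : 'I_(nmon n m) := sval (cid (monom_exists f)).

Lemma monomE (f : {ffun 'I_m -> 'I_n}) (z : 'cV[R]_n) :
  \prod_s z (f s) 0 = (moncoef (monom f))^-1 * vpow m z (monom f) 0.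
Proof. by rewrite /monom; case: cid. Qed.

(** Kronecker substitution: z_i = s^((m+1)^i) sends the monomials to distinct
    powers of s, since the exponents are digits in base m+1. A linear relation
    between the monomials becomes a polynomial in s with infinitely many roots. *)
Lemma vpow_span (xi : 'rV[R]_(nmon n m)) :
  (forall z : 'cV[R]_n, xi *m vpow m z = 0) -> xi = 0.
Proof.
move=> xi0; apply/rowP => k; rewrite [RHS]mxE.
pose code (l : 'I_(nmon n m)) := (\sum_(i < n) tnth (monexp l) i * m.+1 ^ i)%N.
pose p : {poly R} := \sum_l (xi 0 l * moncoef l) *: 'X^(code l).
have p_root (s : R) : root p s.
  pose z : 'cV[R]_n := \col_i s ^+ (m.+1 ^ i).
  have /matrixP/(_ 0 0) := xi0 z; rewrite !mxE => xiz.
  rewrite /root horner_sum -[X in _ == X]xiz; apply/eqP; apply: eq_bigr => l _.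
  rewrite hornerZ hornerXn vpowE -mulrA; congr (_ * (_ * _)).
  rewrite /code -prodrXr; apply: eq_bigr => i _.
  by rewrite mxE mulnC exprM.
have p0 : p = 0.
  apply: (@roots_geq_poly_eq0 _ p [seq i%:R | i <- iota 0 (size p)]).
  - by apply/allP => s _; exact: p_root.
  - rewrite map_inj_uniq ?iota_uniq// => i j ij; apply/eqP.
    by rewrite -(eqr_nat R) ij.
  - by rewrite size_map size_iota.
have := congr1 (fun q : {poly R} => q`_(code k)) p0.
rewrite coef0 coef_sum (bigD1 k)//= coefZ coefXn eqxx mulr1 big1 ?addr0.
  by move=> /eqP; rewrite mulf_eq0 (gt_eqF (moncoef_gt0 k)) orbF => /eqP.
move=> l lk; rewrite coefZ coefXn; case: eqP => [kl|_]; last by rewrite mulr0.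
case/eqP: lk; apply: monexp_inj => i.
have := @digits_inj m.+1 n (fun i => nth ord0 (monexp l) i)
  (fun i => nth ord0 (monexp k) i).
rewrite !(tnth_nth ord0); apply=> //.
by rewrite -/(nat_of_ord _); under eq_bigr do rewrite -tnth_nth;
   under [RHS]eq_bigr do rewrite -tnth_nth; rewrite -/(code l) -/(code k) kl.
Qed.

End monomials.

(** * Symmetric powers of a matrix *)

Section symmetric_power.
Variables (R : realType) (n m : nat).
Implicit Types (L A : 'M[R]_n).

Definition sympow_coef (k : 'I_(nmon n m)) (f : {ffun 'I_m -> 'I_n}) : R :=
  moncoef R k / moncoef R (monom R f).

(** The matrix induced by L on degree m monomials: expand the product of the m
    linear forms (L z)_(w s) over all words f, and collect the words with the same
    exponents. *)
Definition sympow L : 'M[R]_(nmon n m) := \matrix_(k, l)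
  \sum_(f : {ffun 'I_m -> 'I_n} | monom R f == l)
     sympow_coef k f * \prod_s L (word R k s) (f s).

Lemma sympow_vpow L (z : 'cV[R]_n) : sympow L *m vpow m z = vpow m (L *m z).
Proof.
apply/colP => k; rewrite mxE vpow_word.
under [in RHS]eq_bigr do rewrite mxE.
rewrite bigA_distr_bigA big_distrr /= (partition_big (@monom R n m) xpredT)//=.
apply: eq_bigr => l _; rewrite mxE big_distrl /=; apply: eq_bigr => f /eqP fl.
by rewrite big_split /= monomE fl /sympow_coef fl; ring.
Qed.

(** The coefficients of a linear form in the monomials being unique, the matrix
    acting as the identity on all vectors of monomials is the identity. *)
Lemma sympow1 : sympow 1%:M = 1%:M.
Proof.
apply/row_matrixP => k; apply/eqP; rewrite -subr_eq0 -raddfB /=; apply/eqP.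
apply: vpow_span => z.
by rewrite -row_mul mulmxBl sympow_vpow !mul1mx subrr raddf0.
Qed.

Definition sympow_poly A (k l : 'I_(nmon n m)) : {poly R} :=
  \sum_(f : {ffun 'I_m -> 'I_n} | monom R f == l)
     sympow_coef k f *: \prod_s ((word R k s == f s)%:R%:P + A (word R k s) (f s) *: 'X).

Lemma sympow_polyE A k l (h : R) :
  (sympow_poly A k l).[h] = sympow (1%:M + h *: A) k l.
Proof.
rewrite horner_sum mxE; apply: eq_bigr => f _; rewrite hornerZ horner_prod.
congr (_ * _); apply: eq_bigr => s _.
by rewrite hornerD hornerZ hornerX hornerC !mxE mulrC.
Qed.

(** The derivative of the symmetric power along 1 + h A; its entries are
    polynomials in h, which makes the derivative formal. *)
Definition symgen A : 'M[R]_(nmon n m) :=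
  \matrix_(k, l) (sympow_poly A k l)^`().[0].

Lemma sympow_derive A k l :
  (sympow (1%:M + h *: A) k l - (k == l)%:R) / h @[h --> 0^'] --> symgen A k l.
Proof.
have [/cvg_ex[/= v dv] vE] := @is_derive_poly R (sympow_poly A k l) 0.
have := dv; rewrite mxE -vE /derive.
move/(cvg_lim (@Rhausdorff R)) => ->; apply: cvg_trans dv.
apply: near_eq_cvg; apply: nearW => h /=.
have s1 : sympow 1%:M k l = (k == l)%:R by rewrite sympow1 mxE.
by rewrite scaler1 addr0 !sympow_polyE scale0r addr0 s1 mulrC.
Qed.

(** Leibniz' rule: the derivative of a product, given the factors v and their
    derivatives dv. *)
Fixpoint diffprod (I : Type) (s : seq I) (v dv : I -> R) : R :=
  if s is i :: s' then v i * diffprod s' v dv + dv i * \prod_(j <- s') v j else 0.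

Lemma is_derive_prod (I : Type) (s : seq I) (f : I -> R -> R) (df : I -> R) (t : R) :
  (forall i, is_derive t 1 (f i) (df i)) ->
  is_derive t 1 (fun u => \prod_(i <- s) f i u) (diffprod s (f ^~ t) df).
Proof.
move=> dfE; elim: s => [|i s IH].
  under eq_fun do rewrite big_nil; exact: is_derive_cst.
under eq_fun do rewrite big_cons.
have := is_deriveM (dfE i) IH; rewrite /= => /trigger_derive; apply.
by congr (_ + _); rewrite mulrC.
Qed.

Definition dvpow (z w : 'cV[R]_n) : 'cV[R]_(nmon n m) :=
  \col_k (moncoef R k * diffprod (index_enum 'I_m)
    (fun s => z (word R k s) 0) (fun s => w (word R k s) 0)).

Lemma is_derive_vpow (x : R -> 'cV[R]_n) (w : 'cV[R]_n) (t : R) :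
  is_derive t 1 x w -> is_derive t 1 (fun s => vpow m (x s)) (dvpow (x t) w).
Proof.
move=> /is_derive_mxP dx; apply/is_derive_mxP => k j; rewrite (ord1 j) mxE.
under eq_fun do rewrite vpow_word.
have := is_derive_prod (index_enum 'I_m) (fun s => dx (word R k s) 0).
by move=> /(is_deriveZ (moncoef R k)).
Qed.

Lemma is_derive_line (z w : 'cV[R]_n) (t : R) :
  is_derive t 1 (fun h : R => z + h *: w) w.
Proof.
apply/is_derive_mxP => i j.
have := @is_derive_poly R ((z i j)%:P + w i j *: 'X) t.
rewrite derivD derivC add0r derivZ derivX hornerZ hornerC mulr1.
rewrite (_ : horner _ = fun h => (z + h *: w) i j)//.
by apply/funext => h; rewrite hornerD hornerC hornerZ hornerX !mxE mulrC.
Qed.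

(** Both sides are the derivative at h = 0 of the monomials along z + h A z. *)
Lemma symgen_vpow A (z : 'cV[R]_n) : symgen A *m vpow m z = dvpow z (A *m z).
Proof.
have dline := is_derive_line z (A *m z) 0.
have := is_derive_vpow dline; rewrite scale0r addr0 => /is_derive_mxP dv.
apply/matrixP => k j; rewrite (ord1 j) mxE.
have [_ <-] := dv k 0.
have -> : (fun h : R => vpow m (z + h *: (A *m z)) k 0) =
    horner (\sum_l (vpow m z l 0) *: sympow_poly A k l).
  apply/funext => h; rewrite scalemxAl -{1}[z]mul1mx -mulmxDl -sympow_vpow mxE.
  by rewrite horner_sum; apply: eq_bigr => l _; rewrite hornerZ sympow_polyE mulrC.
have [_ ->] := @is_derive_poly R (\sum_l (vpow m z l 0) *: sympow_poly A k l) 0.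
rewrite raddf_sum horner_sum; apply: eq_bigr => l _.
by rewrite [symgen A k l]mxE /= derivZ hornerZ mulrC.
Qed.

End symmetric_power.

(** * The matrix exponential and the derivative of the symmetric power *)

Section linear_ode.
Variables (R : realType) (n : nat) (A : 'M[R]_n).

(** The power series of exp (t A) z, coordinate by coordinate. *)
Definition flow_coef (z : 'cV[R]_n) (i : 'I_n) : R^nat :=
  fun k => iter k (mulmx A) z i 0 / k`!%:R.

Definition flow (t : R) (z : 'cV[R]_n) : 'cV[R]_n :=
  \col_i limn (pseries (flow_coef z i) t).

Lemma iter_mulmx_norm_le k (z : 'cV[R]_n) :
  `|iter k (mulmx A) z| <= mxsize A ^+ k * `|z|.
Proof.
elim: k => [|k IH]; first by rewrite expr0 mul1r.
rewrite iterS (le_trans (mulmx_norm_le _ _))// exprS -mulrA.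
by rewrite ler_wpM2l ?mxsize_ge0.
Qed.

Lemma flow_coef_cvg z i (t : R) : cvgn (pseries (flow_coef z i) t).
Proof.
apply: normed_cvg.
apply: (@series_le_cvg _ _ (`|z| *: exp_coeff (mxsize A * `|t|))).
- by move=> k /=.
- move=> k /=; rewrite /exp_coeff /= mulr_ge0// divr_ge0// exprn_ge0//.
  by rewrite mulr_ge0 ?mxsize_ge0.
- move=> k; rewrite /flow_coef /exp_coeff /= normrM normrM normfV normrX.
  rewrite [`|_`!%:R|]ger0_norm// -[leRHS]/(`|z| * ((mxsize A * `|t|) ^+ k / k`!%:R)).
  have -> : `|z| * ((mxsize A * `|t|) ^+ k / k`!%:R) =
      mxsize A ^+ k * `|z| / k`!%:R * `|t| ^+ k by rewrite exprMn; ring.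
  rewrite ler_wpM2r ?exprn_ge0// ler_wpM2r ?invr_ge0//.
  by rewrite (le_trans (entry_le_norm _ _))// iter_mulmx_norm_le.
- apply: is_cvg_seriesZ; exact: is_cvg_series_exp_coeff.
Qed.

Lemma flow_coef_diffs z i : pseries_diffs (flow_coef z i) = flow_coef (A *m z) i.
Proof.
apply/funext => k; rewrite /pseries_diffs /flow_coef -iterSr /= factS natrM.
by rewrite invfM mulrCA mulVKf// pnatr_eq0.
Qed.

Lemma flow_mulmx (t : R) z : flow t (A *m z) = A *m flow t z.
Proof.
apply/colP => i; rewrite !mxE; apply/cvg_lim => //.
under eq_bigr do rewrite mxE.
have -> : pseries (flow_coef (A *m z) i) t =
    (fun k => \sum_j A i j * pseries (flow_coef z j) t k).
  apply/funext => k; rewrite /pseries /series /=.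
  under [RHS]eq_bigr do rewrite big_distrr /=.
  rewrite exchange_big /=; apply: eq_bigr => l _.
  rewrite /flow_coef -iterSr iterS mxE !big_distrl /=; apply: eq_bigr => j _.
  by rewrite !mulrA.
apply: cvg_big => [|j _]; first exact: add_continuous.
 apply: cvgMr; exact: flow_coef_cvg.
Qed.

Lemma flow0 z : flow 0 z = z.
Proof.
apply/colP => i; rewrite mxE; apply/cvg_lim => //.
rewrite -cvg_shiftS; apply: cvg_near_cst; apply: nearW => k /=.
rewrite /pseries /series /= big_nat_recl// big1 ?addr0 => [|l _].
  by rewrite /flow_coef /= expr0 mulr1 divr1.
by rewrite exprS mul0r mulr0.
Qed.

Lemma is_derive_flow (t : R) z : is_derive t 1 (flow ^~ z) (A *m flow t z).
Proof.
apply/is_derive_mxP => i j; rewrite -flow_mulmx mxE -flow_coef_diffs.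
under eq_fun do rewrite mxE.
apply: (@pseries_snd_diffs _ _ (`|t| + 1)); rewrite ?flow_coef_diffs.
- exact: flow_coef_cvg.
- exact: flow_coef_cvg.
- exact: flow_coef_cvg.
- by rewrite [ltRHS]ger0_norm ?addr_ge0// ltrDl.
Qed.

End linear_ode.

(** The derivative of monomials along a solution depends on the solution only
    through its current position, so symgen has the property that defines mlift.
    Uniqueness needs a solution through every point, provided by the exponential,
    and the independence of monomials. *)
Lemma mlift_symgen (R : realType) (n m : nat) (A : 'M[R]_n) : mlift m A = symgen m A.
Proof.
rewrite /mlift; set S := [set B | _].
have S_symgen : S (symgen m A).
  move=> x dx t; have := is_derive_vpow m (dx t).
  by rewrite symgen_vpow.
have S_mlift := xgetI (P := S) 0 S_symgen.
apply/row_matrixP => k; apply/eqP; rewrite -subr_eq0 -raddfB /=; apply/eqP.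
apply: vpow_span => z; rewrite -row_mul mulmxBl.
have dflow t := is_derive_flow A t z.
have [_ v1] := S_mlift _ dflow 0.
have [_ v2] := S_symgen _ dflow 0.
by move: v1; rewrite v2 flow0 => <-; rewrite subrr raddf0.
Qed.

(** * Powers of a perturbed Euler matrix *)

Lemma cvg_step (R : realType) (t : R) : 0 < t -> t / k.+1%:R @[k --> \oo] --> (0 : R)^'+.
Proof.
move=> t0 B [e /= e0 eB].
have hcvg : t / k.+1%:R @[k --> \oo] --> (0 : R).
  by rewrite -[X in _ --> X](mulr0 t); apply: cvgMr; exact: cvg_harmonic.
have [j _ jB] := (cvgrPdist_lt _ _).1 hcvg e e0.
by exists j => // k jk; apply: eB; [exact: jB|rewrite divr_gt0].
Qed.

Section euler_powers.
Variables (R : realType) (p : nat).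
Implicit Types (M L S : 'M[R]_p) (u : 'cV[R]_p).

Lemma mxsizeD (M L : 'M[R]_p) : mxsize (M + L) <= mxsize M + mxsize L.
Proof.
rewrite /mxsize -big_split /=; apply: ler_sum => i _.
rewrite -big_split /=; apply: ler_sum => j _.
by rewrite mxE ler_normD.
Qed.

Lemma mulmx1D_norm_le S (h c : R) u : 0 <= h -> mxsize S <= c ->
  `|(1%:M + h *: S) *m u| <= (1 + h * c) * `|u|.
Proof.
move=> h0 Sc; rewrite mulmxDl mul1mx -scalemxAl mulrDl mul1r.
rewrite (le_trans (ler_normD _ _))// lerD2l normrZ ger0_norm// -mulrA ler_wpM2l//.
by rewrite (le_trans (mulmx_norm_le _ _))// ler_wpM2r.
Qed.

(** Telescoping: k replacements of one factor, each costing e, among k factors of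
    size at most 1 + c. *)
Lemma iter_mulmx_perturbation M L (c e : R) k u : 0 <= c -> 0 <= e ->
  (forall v : 'cV[R]_p, `|M *m v| <= (1 + c) * `|v|) ->
  (forall v : 'cV[R]_p, `|L *m v| <= (1 + c) * `|v|) ->
  (forall v : 'cV[R]_p, `|(M - L) *m v| <= e * `|v|) ->
  `|iter k (mulmx M) u - iter k (mulmx L) u| <= k%:R * e * (1 + c) ^+ k * `|u|.
Proof.
move=> c0 e0 Mc Lc MLe; have c1 : 0 <= 1 + c by rewrite addr_ge0.
have Lk j : `|iter j (mulmx L) u| <= (1 + c) ^+ j * `|u|.
  elim: j => [|j IH]; first by rewrite expr0 mul1r.
  by rewrite iterS (le_trans (Lc _))// exprS -mulrA ler_wpM2l.
elim: k => [|k IH]; first by rewrite subrr normr0 !mul0r.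
rewrite !iterS.
have -> : M *m iter k (mulmx M) u - L *m iter k (mulmx L) u =
    M *m (iter k (mulmx M) u - iter k (mulmx L) u) + (M - L) *m iter k (mulmx L) u.
  by rewrite mulmxBr mulmxBl addrA subrK.
rewrite (le_trans (ler_normD _ _))//.
have -> : k.+1%:R * e * (1 + c) ^+ k.+1 * `|u| =
    (1 + c) * (k%:R * e * (1 + c) ^+ k * `|u|) + e * ((1 + c) ^+ k.+1 * `|u|).
  by rewrite -natr1 exprS; ring.
apply: lerD.
  by rewrite (le_trans (Mc _))// ler_wpM2l.
rewrite (le_trans (MLe _))// ler_wpM2l// (le_trans (Lk k))// ler_wpM2r//.
by rewrite exprS ler_peMl ?exprn_ge0// lerDl.
Qed.

(** If M(h) = 1 + h S + h E(h) with E(h) tending to 0, then K = t / h factors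
    differ in total by at most K h |E(h)| exp (t (|S| + |E(h)|)), which tends
    to 0. *)
Lemma iter_mulmx_euler (M : R -> 'M[R]_p) S (t : R) u : 0 < t ->
  (forall i j, (M h i j - (i == j)%:R) / h @[h --> 0^'+] --> S i j) ->
  `|iter k.+1 (mulmx (M (t / k.+1%:R))) u -
    iter k.+1 (mulmx (1%:M + (t / k.+1%:R) *: S)) u| @[k --> \oo] --> (0 : R).
Proof.
move=> t0 MS.
have hE := cvg_step t0.
pose E k := (t / k.+1%:R)^-1 *: (M (t / k.+1%:R) - 1%:M) - S.
have E0 : mxsize (E k) @[k --> \oo] --> (0 : R).
  have -> : (0 : R) = \sum_(i < p) \sum_(j < p) 0.
    by rewrite big1// => i _; rewrite big1.
  apply: cvg_big => [|i _]; first exact: add_continuous.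
  apply: cvg_big => [|j _]; first exact: add_continuous.
  have -> : (0 : R) = `|S i j - S i j| by rewrite subrr normr0.
  apply: cvg_trans (cvg_norm (cvgB (cvg_comp _ _ hE (MS i j)) (cvg_cst (S i j)))).
  by apply: near_eq_cvg; apply: nearW => k /=; rewrite !mxE !fctE /= mulrC.
pose c k := mxsize S + mxsize (E k).
have bound : t * mxsize (E k) * expR (t * c k) * `|u| @[k --> \oo] --> (0 : R).
  rewrite -[X in _ --> X](mul0r `|u|); apply: cvgM; last exact: cvg_cst.
  rewrite -(mul0r (expR (t * (mxsize S + 0)))); apply: cvgM.
    by rewrite -(mulr0 t); apply: cvgM; [exact: cvg_cst|exact: E0].
  apply: continuous_cvg; first exact: continuous_expR.
  by apply: cvgM; [exact: cvg_cst|apply: cvgD; [exact: cvg_cst|exact: E0]].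
apply: (squeeze_cvgr _ (cvg_cst 0) bound).
apply: nearW => k; rewrite normr_ge0 andTb.
set h := t / k.+1%:R.
have h0 : 0 < h by rewrite divr_gt0.
have ME : M h = 1%:M + h *: (S + E k).
  by rewrite /E -/h [S + _]addrC subrK scalerA divff ?gt_eqF// scale1r addrC subrK.
have c0 : 0 <= c k by rewrite addr_ge0 ?mxsize_ge0.
apply: (@le_trans _ _ (k.+1%:R * (h * mxsize (E k)) * (1 + h * c k) ^+ k.+1 * `|u|)).
  apply: iter_mulmx_perturbation => [||v|v|v].
  - by rewrite mulr_ge0// ltW.
  - by rewrite mulr_ge0 ?mxsize_ge0// ltW.
  - by rewrite ME mulmx1D_norm_le ?(ltW h0)// mxsizeD.
  - by rewrite mulmx1D_norm_le ?(ltW h0)// lerDl mxsize_ge0.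
  - rewrite ME scalerDr addrA [_ - _]addrC addKr -scalemxAl normrZ gtr0_norm//.
    by rewrite -mulrA ler_wpM2l ?(ltW h0)// mulmx_norm_le.
have ht : k.+1%:R * h = t by rewrite /h mulrC divfK// pnatr_eq0.
rewrite mulrA ht ler_wpM2r// ler_wpM2l ?mulr_ge0 ?mxsize_ge0 ?(ltW t0)//.
have growth : (1 + h * c k) ^+ k.+1 <= expR (k.+1%:R * (h * c k)).
  by apply: expr1D_le_expR; rewrite addr_ge0// mulr_ge0// ltW.
by rewrite (le_trans growth)// mulrA ht.
Qed.

End euler_powers.

(** * Exponential decay for Hurwitz matrices *)

Section hurwitz_decay.
Variable R : realType.
Local Notation C := (complex R).
Local Notation normc := (@ComplexField.Normc.normc R).
Local Notation "z %:C" := (real_complex R z).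
Implicit Type z : C.

Lemma normc_ge0 z : 0 <= normc z.
Proof. by case: z => a b; exact: sqrtr_ge0. Qed.

Lemma normc_real (a : R) : normc a%:C = `|a|.
Proof. by rewrite /= expr0n/= addr0 sqrtr_sqr. Qed.

Lemma normc_sum (I : Type) (s : seq I) (Pr : pred I) (F : I -> C) :
  normc (\sum_(i <- s | Pr i) F i) <= \sum_(i <- s | Pr i) normc (F i).
Proof.
elim/big_ind2 : _ => [|x x' y y' xx' yy'|//]; first by rewrite ComplexField.Normc.normc0.
by rewrite (le_trans (le_normcD _ _))// lerD.
Qed.

(** The square of the modulus is (1 + h a)^2 + (h b)^2; the term 2 h a, with a < 0,
    absorbs those of order h^2. *)
Lemma normc_euler_le (a b h : R) : a < 0 -> 0 <= h -> h * (a ^+ 2 + b ^+ 2) <= - a ->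
  normc (1 + h%:C * Complex a b) <= 1 + h * a / 2.
Proof.
move=> a0 h0 hab.
have ha : 0 <= 1 + h * a / 2.
  have : h * a ^+ 2 <= - a.
    by rewrite (le_trans _ hab)// ler_wpM2l// lerDl sqr_ge0.
  have -> : h * a ^+ 2 = (- (h * a)) * - a by ring.
  rewrite -[X in _ <= X -> _]mul1r ler_pM2r ?oppr_gt0// => ?; lra.
rewrite -[leRHS](ger0_norm ha) -sqrtr_sqr ler_sqrt ?sqr_ge0//=.
have : h * (h * (a ^+ 2 + b ^+ 2)) <= h * - a by rewrite ler_wpM2l.
have := sqr_ge0 (h * a).
rewrite !mul0r subr0 !addr0; nra.
Qed.

Lemma normc_euler_near z : complex.Re z < 0 ->
  \forall h \near (0 : R)^'+, normc (1 + h%:C * z) <= 1 + h * complex.Re z / 2.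
Proof.
case: z => a b /= a0; pose q := a ^+ 2 + b ^+ 2 + 1.
have q0 : 0 < q by rewrite ltr_wpDl// addr_ge0// sqr_ge0.
have e0 : 0 < - a / q by rewrite divr_gt0// oppr_gt0.
near=> h.
have h0 : 0 <= h by apply: ltW; near: h; exact: nbhs_right_gt.
have hq : h * q <= - a.
  by rewrite -ler_pdivlMr//; near: h; exact: nbhs_right_le.
apply: normc_euler_le => //; apply: le_trans hq.
by rewrite ler_wpM2l// lerDl.
Unshelve. all: by end_near. Qed.

Variable p : nat.
Implicit Types (M : 'M[C]_p.+1) (v : 'cV[C]_p.+1).

(** In the norm with weights E^(-i) on the coordinates, the part of M below the
    diagonal has size at most s / E, where s is the sum of the moduli of all
    entries. For large E it is dominated by the decay b coming from the diagonal,
    and 1 + h M becomes a contraction. *)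
Lemma trig_euler_contraction M (b : R) : 0 < b -> is_trig_mx M ->
  (forall i, complex.Re (M i i) <= - b) -> exists2 E : R, 1 <= E &
  \forall h \near (0 : R)^'+, 0 <= 1 - h * (b / 4) /\
   forall v (c : R), 0 <= c -> (forall i, normc (v i 0) <= c * E ^+ i) ->
   forall i, normc (((1%:M + h%:C *: M) *m v) i 0) <= (1 - h * (b / 4)) * c * E ^+ i.
Proof.
move=> b0 /is_trig_mxP M_trig Mb.
pose s := \sum_i \sum_j normc (M i j).
have s0 : 0 <= s by apply: sumr_ge0 => i _; apply: sumr_ge0 => j _; exact: normc_ge0.
(* This weight gives s / E <= b / 4, half of the decay b / 2 of the diagonal. *)
pose E := 1 + 4 * s / b.
have E1 : 1 <= E by rewrite lerDl divr_ge0 ?mulr_ge0 ?(ltW b0).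
have sE : s <= b / 4 * E.
  have -> : b / 4 * E = b / 4 + s by rewrite /E; field; rewrite gt_eqF.
  by rewrite lerDr divr_ge0// ltW.
exists E => //; near=> h.
have h0 : 0 <= h by apply: ltW; near: h; exact: nbhs_right_gt.
have diag i : normc (1 + h%:C * M i i) <= 1 - h * (b / 2).
  apply: (@le_trans _ _ (1 + h * complex.Re (M i i) / 2)).
    move: i; near: h; apply: filter_forall => i.
    by apply: normc_euler_near; rewrite (le_lt_trans (Mb i))// oppr_lt0.
  have := ler_wpM2l h0 (Mb i); lra.
have hb := mulr_ge0 h0 (ltW b0).
split; first by have := le_trans (normc_ge0 _) (diag ord0); lra.
move=> v c c0 vc i.
have E0 k : 0 <= E ^+ k by rewrite exprn_ge0// (le_trans _ E1).
have -> : ((1%:M + h%:C *: M) *m v) i 0 = (1 + h%:C * M i i) * v i 0 +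
    \sum_(j | j != i) h%:C * M i j * v j 0.
  rewrite mxE (bigD1 i)//= !mxE eqxx; congr (_ + _).
  by apply: eq_bigr => j ji; rewrite !mxE eq_sym (negbTE ji) add0r.
have -> : (1 - h * (b / 4)) * c * E ^+ i =
    (1 - h * (b / 2)) * (c * E ^+ i) + h * (b / 4) * (c * E ^+ i) by field.
rewrite (le_trans (le_normcD _ _))// lerD//.
  by rewrite ComplexField.Normc.normcM ler_pM ?normc_ge0.
rewrite (le_trans (normc_sum _ _ _))//.
apply: (@le_trans _ _ (\sum_j h * normc (M i j) * (c * E ^+ i / E))).
  rewrite [leRHS](bigD1 i)//= ler_wpDl//.
    by rewrite !mulr_ge0 ?normc_ge0// invr_ge0 (le_trans _ E1).
  apply: ler_sum => j ji.
  rewrite !ComplexField.Normc.normcM normc_real ger0_norm//.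
  have [ij|ij] := ltnP i j.
    by rewrite M_trig// ComplexField.Normc.normc0 mulr0 !mul0r.
  rewrite ler_wpM2l ?mulr_ge0 ?normc_ge0// (le_trans (vc j))// -mulrA ler_wpM2l//.
  have {ij ji}ji : (j < i)%N by rewrite ltn_neqAle ij andbT.
  rewrite ler_pdivlMr ?(lt_le_trans _ E1)// -exprSr.
  by rewrite ler_weXn2l.
rewrite -big_distrl /= -big_distrr /=.
have -> : h * (b / 4) * (c * E ^+ i) = h * (b / 4 * E) * (c * E ^+ i / E).
  by field; rewrite gt_eqF// (lt_le_trans _ E1).
rewrite ler_wpM2r ?mulr_ge0 ?invr_ge0 ?(le_trans _ E1)// ler_wpM2l//.
apply: le_trans sE; rewrite /s [leRHS](bigD1 i)//= lerDl.
by apply: sumr_ge0 => k _; apply: sumr_ge0 => j _; exact: normc_ge0.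
Unshelve. all: by end_near. Qed.

End hurwitz_decay.

Section hurwitz_decay_theorem.
Variable R : realType.
Local Notation C := (complex R).
Local Notation normc := (@ComplexField.Normc.normc R).
Local Notation cplx := (map_mx (real_complex R)).

Definition normc_size p (M : 'M[C]_p) : R := \sum_i \sum_j normc (M i j).

Lemma normc_size_ge0 p (M : 'M[C]_p) : 0 <= normc_size M.
Proof. by apply: sumr_ge0 => i _; apply: sumr_ge0 => j _; exact: normc_ge0. Qed.

Lemma normc_mulmx_le p (M : 'M[C]_p) (v : 'cV[C]_p) (c : R) i :
  (forall j, normc (v j 0) <= c) -> normc ((M *m v) i 0) <= normc_size M * c.
Proof.
move=> vc; have c0 : 0 <= c by rewrite (le_trans _ (vc i)) ?normc_ge0.
rewrite mxE (le_trans (normc_sum _ _ _))// /normc_size.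
rewrite [X in X * c](bigD1 i)//= mulrDl -[leLHS]addr0 lerD//; last first.
  rewrite mulr_ge0//; apply: sumr_ge0 => k _.
  by apply: sumr_ge0 => j _; exact: normc_ge0.
rewrite big_distrl /=; apply: ler_sum => j _.
by rewrite ComplexField.Normc.normcM ler_wpM2l ?normc_ge0.
Qed.

Lemma iter_mulmx_map p (M : 'M[R]_p) (u : 'cV[R]_p) k :
  cplx (iter k (mulmx M) u) = iter k (mulmx (cplx M)) (cplx u).
Proof. by elim: k => //= k <-; rewrite map_mxM. Qed.

Lemma iter_mulmx_conj p (B M L : 'M[C]_p) (v : 'cV[C]_p) k : B *m M = L *m B ->
  B *m iter k (mulmx M) v = iter k (mulmx L) (B *m v).
Proof. by move=> BM; elim: k => //= k <-; rewrite !mulmxA BM. Qed.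

(** Schur's triangular form; the diagonal entries of a triangular matrix are its
    eigenvalues, and conjugation does not change them. *)
Lemma hurwitz_trig p (S : 'M[R]_p.+1) : hurwitz S ->
  exists B L : 'M[C]_p.+1, [/\ B \in unitmx, B *m (cplx S) = L *m B, is_trig_mx L &
    forall i, complex.Re (L i i) < 0].
Proof.
move=> S_hurwitz; have [B B_unitary BS] := @Schur C p.+1 (cplx S) isT.
have B_unit : B \in unitmx by exact: unitarymx_unit.
exists B, (conjmx B (cplx S)); split => //.
  by rewrite conjumx// mulmxKV.
move=> i; apply: S_hurwitz.
apply: (@eigenvalue_conjmx _ _ _ B); first by rewrite stablemx_unit.
  by rewrite row_free_unit.
rewrite [_ \in _]eigenvalue_root_char char_poly_trig//.
by rewrite /root horner_prod (bigD1 i)//= hornerXsubC subrr mul0r.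
Qed.

Lemma hurwitz_decay p (S : 'M[R]_p) : hurwitz S ->
  exists c b : R, [/\ 0 <= c, 0 < b & forall (t : R) (u : 'cV[R]_p), 0 < t ->
   \forall k \near \oo,
    `|iter k.+1 (mulmx (1%:M + (t / k.+1%:R) *: S)) u| <= c * expR (- (b * t)) * `|u|].
Proof.
case: p S => [|p] S S_hurwitz.
  exists 0, 1; split=> // t u t0; apply: nearW => k; rewrite !mul0r.
  by apply: norm_le_entries => // -[].
have [B [L [B_unit BS L_trig L_neg]]] := hurwitz_trig S_hurwitz.
have [b b0 Lb] : exists2 b : R, 0 < b & forall i, complex.Re (L i i) <= - b.
  exists (\big[Num.min/1]_i (- complex.Re (L i i))).
    by apply/bigmin_gtP; split=> // i _; rewrite oppr_gt0.
  by move=> i; rewrite lerNr; exact: bigmin_le_cond.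
have [E E1 contr] := trig_euler_contraction b0 L_trig Lb.
have E0 : 0 <= E by rewrite (le_trans _ E1).
exists (normc_size (invmx B) * normc_size B * E ^+ p), (b / 4); split.
- by rewrite !mulr_ge0 ?normc_size_ge0 ?exprn_ge0.
- by rewrite divr_gt0.
move=> t u t0; have [k0 _ near_k] := cvg_step t0 contr; exists k0 => // k /near_k.
rewrite /=; set h := t / k.+1%:R => -[rho0 step].
set M := 1%:M + h *: S.
have BM : B *m (cplx M) = (1%:M + h%:C%C *: L) *m B.
  rewrite map_mxD map_scalar_mx rmorph1 map_mxZ mulmxDr mulmxDl mulmx1 mul1mx.
  by rewrite -scalemxAr BS scalemxAl.
pose w := B *m (cplx u).
pose c0 := normc_size B * `|u|.
have c00 : 0 <= c0 by rewrite mulr_ge0 ?normc_size_ge0.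
have w_le j i : normc (iter j (mulmx (1%:M + h%:C%C *: L)) w i 0)
    <= (1 - h * (b / 4)) ^+ j * c0 * E ^+ i.
  elim: j i => [|j IH] i.
    rewrite expr0 mul1r (@le_trans _ _ c0)//; last by rewrite ler_peMr// exprn_ege1.
    apply: normc_mulmx_le => l; rewrite mxE normc_real.
    exact: entry_le_norm.
  by rewrite iterS exprS -(mulrA (1 - _)) step// mulr_ge0// exprn_ge0.
have rho_exp : (1 - h * (b / 4)) ^+ k.+1 <= expR (- (b / 4 * t)).
  rewrite (le_trans (expr1D_le_expR k.+1 rho0))// ler_expR mulrN lerN2.
  by rewrite /h [leRHS]mulrA [_ * (t / _)]mulrC divfK ?pnatr_eq0// mulrC.
apply: norm_le_entries => [|i].
  by rewrite !mulr_ge0 ?normc_size_ge0 ?exprn_ge0 ?expR_ge0.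
set x := iter k.+1 (mulmx M) u.
have -> : `|x i 0| = normc ((invmx B *m (B *m (cplx x))) i 0).
  by rewrite mulKmx// [map_mx _ x i 0]mxE normc_real.
rewrite iter_mulmx_map (iter_mulmx_conj _ _ BM) -/w.
have -> : normc_size (invmx B) * normc_size B * E ^+ p * expR (- (b / 4 * t)) * `|u|
   = normc_size (invmx B) * (expR (- (b / 4 * t)) * c0 * E ^+ p) by rewrite /c0; ring.
apply: normc_mulmx_le => j; apply: (le_trans (w_le k.+1 j)).
apply: ler_pM; rewrite ?exprn_ge0//.
- by rewrite mulr_ge0// exprn_ge0.
- by rewrite ler_wpM2r.
- by rewrite ler_weXn2l// -ltnS.
Qed.

End hurwitz_decay_theorem.

(** * The Euler matrix of the moments *)

Section stacked_vectors.
Variables (R : realType) (N k : nat).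

Lemma sum_mxtens (F : 'I_(N * k) -> R) :
  \sum_l F l = \sum_i \sum_u F (mxtens_index (i, u)).
Proof.
rewrite pair_big (reindex (@mxtens_index N k)) /=; last first.
  exists (@mxtens_unindex N k) => [[i u]|l] _; first exact: mxtens_indexK.
  exact: mxtens_unindexK.
by apply: eq_big => // -[i u] _.
Qed.

Definition place (i : 'I_N) (z : 'cV[R]_k) : 'cV[R]_(N * k) :=
  \col_l (((mxtens_unindex l).1 == i)%:R * z (mxtens_unindex l).2 0).

Lemma placeE i z j u : place i z (mxtens_index (j, u)) 0 = (j == i)%:R * z u 0.
Proof. by rewrite mxE mxtens_indexK. Qed.

Lemma mul_place (xi : 'rV[R]_(N * k)) i z :
  (xi *m place i z) 0 0 = \sum_u xi 0 (mxtens_index (i, u)) * z u 0.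
Proof.
rewrite mxE sum_mxtens (bigD1 i)//= [X in _ + X]big1 ?addr0 => [|j ji].
  by apply: eq_bigr => u _; rewrite placeE eqxx mul1r.
by rewrite big1// => u _; rewrite placeE (negbTE ji) mul0r mulr0.
Qed.

Lemma norm_place i z : `|place i z| <= `|z|.
Proof.
apply: norm_le_entries => // l; case: (mxtens_indexP l) => j u.
rewrite placeE; case: eqP => _; rewrite ?mul1r ?mul0r ?normr0//.
exact: entry_le_norm.
Qed.

(** The product of the transpose of p, tensored with the identity, and of the block
    diagonal matrix of the S i, written out by entries. *)
Definition stepmx (p : 'M[R]_N) (S : 'I_N -> 'M[R]_k) : 'M[R]_(N * k) :=
  \matrix_(l, l') (p (mxtens_unindex l').1 (mxtens_unindex l).1 *
    S (mxtens_unindex l').1 (mxtens_unindex l).2 (mxtens_unindex l').2).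

Lemma stepmxE p S j u i v :
  stepmx p S (mxtens_index (j, u)) (mxtens_index (i, v)) = p i j * S i u v.
Proof. by rewrite mxE !mxtens_indexK. Qed.

Lemma stepmx_place p S i z :
  stepmx p S *m place i z = \sum_j p i j *: place j (S i *m z).
Proof.
apply/colP => l; case: (mxtens_indexP l) => j u; rewrite summxE (bigD1 j)//=.
rewrite [X in _ + X]big1 ?addr0 => [|j' jj']; last first.
  by rewrite mxE placeE eq_sym (negbTE jj') mul0r mulr0.
rewrite [RHS]mxE placeE eqxx mul1r mxE sum_mxtens (bigD1 i)//=.
rewrite [X in _ + X]big1 ?addr0 => [|i' ii']; last first.
  by rewrite big1// => v _; rewrite placeE (negbTE ii') mul0r mulr0.
rewrite [X in _ = _ * X]mxE big_distrr; apply: eq_bigr => v _.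
by rewrite /= stepmxE placeE eqxx mul1r mulrA.
Qed.

End stacked_vectors.

Section moment_matrix.
Variables (R : realType) (N n m : nat) (A : 'I_N -> 'M[R]_n).

Lemma TmxE (Q : 'M[R]_N) j u i v :
  Tmx m Q A (mxtens_index (j, u)) (mxtens_index (i, v)) =
  Q i j * (u == v)%:R + (j == i)%:R * symgen m (A i) u v.
Proof.
rewrite mxE tensmxE block_diagE !mxE; congr (_ + _).
by case: eqP => [->|_]; rewrite ?mul1r ?mul0r ?mlift_symgen ?mxE.
Qed.

Definition momentmx (p : 'M[R]_N) (h : R) : 'M[R]_(N * nmon n m) :=
  stepmx p (fun i => sympow m (1%:M + h *: A i)).

(** One step of the recursion sends the monomials of z in block i to the monomials
    of (1 + h A_i) z, spread over the blocks j with weights p_ij. This is linear in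
    the monomials, hence given by a matrix. *)
Lemma scheme_mean_momentmx p h (xi : 'rV[R]_(N * nmon n m)) k i z :
  scheme_mean A p h (fun j v => (xi *m place j (vpow m v)) 0 0) k i z =
  (xi *m iter k (mulmx (momentmx p h)) (place i (vpow m z))) 0 0.
Proof.
elim: k i z => [|k IH] i z //; rewrite iterSr stepmx_place.
have iter_sum (F : 'I_N -> 'cV[R]_(N * nmon n m)) l :
    iter l (mulmx (momentmx p h)) (\sum_j p i j *: F j) =
    \sum_j p i j *: iter l (mulmx (momentmx p h)) (F j).
  elim: l => [|l IHl] //; rewrite iterS IHl mulmx_sumr.
  by apply: eq_bigr => j _; rewrite -scalemxAr.
rewrite iter_sum mulmx_sumr summxE /=; apply: eq_bigr => j _.
rewrite IH -scalemxAr [RHS]mxE sympow_vpow.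
by rewrite mulmxDl mul1mx scalemxAl.
Qed.

Lemma momentmx_generator (Q : 'M[R]_N) (p : R -> 'M[R]_N) :
  (forall i j, (p h i j - (i == j)%:R) / h @[h --> 0^'+] --> Q i j) ->
  forall l l', (momentmx (p h) h l l' - (l == l')%:R) / h @[h --> 0^'+] -->
    Tmx m Q A l l'.
Proof.
move=> pQ l l'; case: (mxtens_indexP l) => j u; case: (mxtens_indexP l') => i v.
rewrite TmxE.
have p1 : p h i j @[h --> (0 : R)^'+] --> ((i == j)%:R : R).
  have -> : (i == j)%:R = (i == j)%:R + 0 * Q i j :> R by rewrite mul0r addr0.
  have h0 : h @[h --> (0 : R)^'+] --> (0 : R).
    by apply: cvg_at_right_filter; exact: cvg_id.
  apply: cvg_trans (cvgD (cvg_cst ((i == j)%:R : R)) (cvgM h0 (pQ i j))).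
  apply: near_eq_cvg; near=> h.
  rewrite -[LHS]/((i == j)%:R + h * ((p h i j - (i == j)%:R) / h)).
  have hn0 : h != 0 by rewrite gt_eqF//; near: h; exact: nbhs_right_gt.
  by rewrite [h * _]mulrC divfK// addrC subrK.
have S1 := cvg_dnbhs_at_right (@sympow_derive R n m (A i) u v).
rewrite [Q i j * _ + _]addrC [j == i]eq_sym.
apply: cvg_trans (cvgD (cvgM p1 S1) (cvgM (pQ i j) (cvg_cst ((u == v)%:R : R)))).
apply: near_eq_cvg; near=> h.
rewrite -[LHS]/(p h i j * ((sympow m (1%:M + h *: A i) u v - (u == v)%:R) / h)
  + (p h i j - (i == j)%:R) / h * (u == v)%:R) stepmxE.
have -> : (mxtens_index (j, u) == mxtens_index (i, v))%:R
    = (i == j)%:R * (u == v)%:R :> R.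
  by rewrite (can_eq (@mxtens_indexK N _)) xpair_eqE eq_sym -natrM mulnb.
ring.
Unshelve. all: by end_near. Qed.

End moment_matrix.

(** * Comparison of moments *)

Section scheme_mean_comparison.
Variables (R : realType) (N n : nat) (A : 'I_N -> 'M[R]_n) (p : 'M[R]_N) (h : R).
Hypothesis p0 : forall i j, 0 <= p i j.
Implicit Types (G : 'I_N -> 'cV[R]_n -> R).

(** The relation is kept abstract for two uses: equality, to compare functionals,
    and entrywise domination, to compare initial vectors. *)
Lemma scheme_mean_le G G' (rel : 'cV[R]_n -> 'cV[R]_n -> Prop) k i z w :
  (forall j z w, rel z w -> rel (z + h *: (A j *m z)) (w + h *: (A j *m w))) ->
  (forall j z w, rel z w -> `|G j z| <= G' j w) ->
  rel z w -> `|scheme_mean A p h G k i z| <= scheme_mean A p h G' k i w.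
Proof.
move=> rel_step GG'; elim: k i z w => [|k IH] i z w zw /=; first exact: GG'.
rewrite (le_trans (ler_norm_sum _ _ _))//; apply: ler_sum => j _.
by rewrite normrM ger0_norm// ler_wpM2l// IH//; exact: rel_step.
Qed.

Lemma scheme_mean_scale G (c : R) k i z :
  scheme_mean A p h (fun j v => c * G j v) k i z = c * scheme_mean A p h G k i z.
Proof.
elim: k i z => [|k IH] i z //=; rewrite big_distrr; apply: eq_bigr => j _ /=.
by rewrite IH mulrCA.
Qed.

End scheme_mean_comparison.

Section monomial_bounds.
Variables (R : realType) (n m : nat).

Definition vpow_size : R := \sum_(k < nmon n m) moncoef R k.

Lemma vpow_size_ge0 : 0 <= vpow_size.
Proof. by apply: sumr_ge0 => k _; exact: ltW (moncoef_gt0 R k). Qed.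

Lemma norm_vpow_le (z : 'cV[R]_n) : `|vpow m z| <= vpow_size * `|z| ^+ m.
Proof.
apply: norm_le_entries => [|k].
  by rewrite mulr_ge0 ?vpow_size_ge0 ?exprn_ge0.
rewrite vpow_word normrM gtr0_norm ?moncoef_gt0//; apply: ler_pM => //.
- exact: ltW (moncoef_gt0 R k).
- rewrite /vpow_size (bigD1 k)//= lerDl.
  by apply: sumr_ge0 => l _; exact: ltW (moncoef_gt0 R l).
- rewrite normr_prod -[X in _ ^+ X]card_ord -prodr_const.
  by apply: ler_prod => s _; rewrite normr_ge0 entry_le_norm.
Qed.

Lemma norm_expr_le_sum (z w : 'cV[R]_n) : (0 < m)%N ->
  (forall k, `|z k 0| <= w k 0) -> `|z| ^+ m <= \sum_k w k 0 ^+ m.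
Proof.
move=> m0 zw; have w0 k : 0 <= w k 0 by rewrite (le_trans _ (zw k)).
have sum0 : 0 <= \sum_k w k 0 ^+ m.
  by apply: sumr_ge0 => k _; rewrite exprn_ge0.
have [z0|z0] := eqVneq `|z| 0; first by rewrite z0 expr0n gtn_eqF.
have [[k l]] := @mx_norm_neq0 _ _ _ z z0; rewrite (ord1 l) /= => zk.
have -> : `|z| = `|z k 0| by [].
rewrite (bigD1 k)//= -[leLHS]addr0 lerD//; last first.
  by apply: sumr_ge0 => l' _; rewrite exprn_ge0.
by rewrite lerXn2r ?nnegrE.
Qed.

(** The linear functional of the monomials that computes the sum of the m-th powers
    of the variables; a constant word represents such a power. *)
Definition pure_powers : 'rV[R]_(nmon n m) :=
  \sum_k (moncoef R (monom R [ffun _ : 'I_m => k]))^-1 *: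
    delta_mx 0 (monom R [ffun _ : 'I_m => k]).

Lemma pure_powersE (w : 'cV[R]_n) :
  \sum_u pure_powers 0 u * vpow m w u 0 = \sum_k w k 0 ^+ m.
Proof.
have entry (c : R) l u : (c *: delta_mx 0 l : 'rV[R]_(nmon n m)) 0 u = c * (u == l)%:R.
  by rewrite !mxE.
under eq_bigr do rewrite summxE big_distrl /=.
rewrite exchange_big /=; apply: eq_bigr => k _.
rewrite (bigD1 (monom R [ffun _ : 'I_m => k]))//= big1 ?addr0 => [|u uk].
  rewrite entry eqxx mulr1 -monomE.
  by under eq_bigr do rewrite ffunE; rewrite prodr_const card_ord.
by rewrite entry (negbTE uk) mulr0 mul0r.
Qed.

End monomial_bounds.

(** * Mean stability and the Hurwitz property *)

Section stability.
Variables (R : realType) (d : measure_display) (T : measurableType d).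
Variables (N n m : nat) (Q : 'M[R]_N) (A : 'I_N -> 'M[R]_n).
Variables (P : 'I_N -> probability T R) (r : 'I_N -> R -> T -> 'I_N).
Variable x : 'I_N -> 'cV[R]_n -> R -> T -> 'cV[R]_n.
Hypothesis r_chain : forall i0, markov_chain (P i0) Q i0 (r i0).
Hypothesis x_solution : forall i0 x0, trajectory (P i0) A (r i0) x0 (x i0 x0).

Local Notation S := (Tmx m Q A).
Local Notation step t k := (t / k.+1%:R).
Local Notation moments i0 h := (momentmx m A (transition P r i0 h) h).
Local Notation start i0 z := (place i0 (vpow m z)).

Lemma row_mul_norm_le q (xi : 'rV[R]_q) (u : 'cV[R]_q) :
  `|(xi *m u) 0 0| <= mxsize xi * `|u|.
Proof. exact: le_trans (entry_le_norm _ _) (mulmx_norm_le _ _). Qed.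

Lemma moments_cvg i0 (t : R) (u : 'cV[R]_(N * nmon n m)) : 0 < t ->
  `|iter k.+1 (mulmx (moments i0 (step t k))) u -
    iter k.+1 (mulmx (1%:M + step t k *: S)) u| @[k --> \oo] --> (0 : R).
Proof.
move=> t0; apply: (iter_mulmx_euler (M := fun h => moments i0 h)) => // l l'.
apply: momentmx_generator => i j.
exact: transition_generator.
Qed.

(** For small h, 1 + h A_i has nonnegative entries: off the diagonal because A_i is
    Metzler, on the diagonal because 1 dominates. Nonnegative matrices preserve
    entrywise domination. *)
Lemma metzler_euler_near : (forall i, metzler (A i)) ->
  \forall h \near (0 : R)^'+, forall i (z w : 'cV[R]_n),
    (forall k, `|z k 0| <= w k 0) ->
    forall k, `|(z + h *: (A i *m z)) k 0| <= (w + h *: (A i *m w)) k 0.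
Proof.
move=> A_metzler; near=> h => i z w zw k.
have h0 : 0 <= h by apply: ltW; near: h; exact: nbhs_right_gt.
have hrate : h * (growth_rate A + 1) <= 1.
  rewrite -ler_pdivlMr ?ltr_wpDl ?growth_rate_ge0//; near: h; apply: nbhs_right_le.
  by rewrite divr_gt0// ltr_wpDl ?growth_rate_ge0.
pose B := 1%:M + h *: A i.
have BE (v : 'cV[R]_n) : v + h *: (A i *m v) = B *m v.
  by rewrite mulmxDl mul1mx scalemxAl.
have B0 k1 k2 : 0 <= B k1 k2.
  rewrite !mxE; have [->|k12] := eqVneq k1 k2; last first.
    by rewrite add0r mulr_ge0// A_metzler.
  have Ak : `|A i k2 k2| <= growth_rate A.
    rewrite /growth_rate (bigD1 i)//= /mxsize (bigD1 k2)//= (bigD1 k2)//= -!addrA lerDl.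
    rewrite !addr_ge0 ?sumr_ge0// => j _; last exact: mxsize_ge0.
    by rewrite sumr_ge0.
  have := ler_wpM2l h0 Ak; have := ler_wpM2l h0 (ler_norm (- A i k2 k2)).
  rewrite normrN mulr1n; lra.
rewrite !BE !mxE (le_trans (ler_norm_sum _ _ _))//; apply: ler_sum => j _.
by rewrite normrM ger0_norm// ler_wpM2l.
Unshelve. all: by end_near. Qed.

(** The scheme from x0 is dominated by the scheme from |x0|, where the sum of the
    m-th powers of the entries is a linear functional of the monomials; powers of
    the Euler matrix, hence of 1 + h T_m, bound it. *)
Lemma hurwitz_stable : (0 < m)%N -> (forall i, metzler (A i)) ->
  hurwitz S -> exp_mean_stable P x m.
Proof.
move=> m_gt0 A_metzler /hurwitz_decay[c [b [c0 b0 decay]]].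
pose xi : 'rV[R]_(N * nmon n m) := \row_l pure_powers R n m 0 (mxtens_unindex l).2.
have xiE i (w : 'cV[R]_n) : (xi *m start i w) 0 0 = \sum_k w k 0 ^+ m.
  rewrite mul_place -pure_powersE; apply: eq_bigr => u _.
  by rewrite mxE mxtens_indexK.
pose D := mxsize xi * c * vpow_size R n m.
have D0 : 0 <= D by rewrite !mulr_ge0 ?mxsize_ge0 ?vpow_size_ge0.
exists (D + 1), b; split=> //; first by rewrite ltr_wpDl.
move=> i0 x0 t; rewrite le_eqVlt => /orP[/eqP <-|t0].
  rewrite (moment_start (x_solution i0 x0)) mulr0 oppr0 expR0 mulr1 lee_fin.
  by rewrite ler_peMl ?exprn_ge0// lerDr.
have [e -> cvge] := moment_limit r_chain (x_solution i0 x0) m t0.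
pose w := \col_k `|x0 k 0| : 'cV[R]_n.
have w_norm : `|w| <= `|x0|.
  by apply: norm_le_entries => // k; rewrite mxE normr_id entry_le_norm.
pose gap k := `|iter k.+1 (mulmx (moments i0 (step t k))) (start i0 w) -
    iter k.+1 (mulmx (1%:M + step t k *: S)) (start i0 w)|.
pose lim_bound := mxsize xi * (c * expR (- (b * t)) * `|start i0 w| + 0).
have bound_cvg : mxsize xi * (c * expR (- (b * t)) * `|start i0 w| + gap k) @[k --> \oo]
    --> lim_bound.
  by apply: cvgMr; apply: cvgD; [exact: cvg_cst|exact: moments_cvg].
rewrite lee_fin; apply: (@le_trans _ _ lim_bound); last first.
  rewrite /lim_bound addr0.
  apply: (@le_trans _ _ (D * expR (- (b * t)) * `|x0| ^+ m)); last first.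
    by rewrite ler_wpM2r ?exprn_ge0// ler_wpM2r ?expR_ge0// lerDl.
  have -> : D * expR (- (b * t)) * `|x0| ^+ m = mxsize xi *
     (c * expR (- (b * t)) * (vpow_size R n m * `|x0| ^+ m)) by rewrite /D; ring.
  rewrite ler_wpM2l ?mxsize_ge0// ler_wpM2l ?mulr_ge0 ?expR_ge0//.
  rewrite (le_trans (norm_place _ _))// (le_trans (norm_vpow_le _ _))//.
  by rewrite ler_wpM2l ?vpow_size_ge0// lerXn2r ?nnegrE.
apply: (ler_cvg_to cvge bound_cvg).
have [k0 _ near_h] := cvg_step t0 (metzler_euler_near A_metzler).
near=> k.
have step_rel : forall i (z v : 'cV[R]_n), (forall k, `|z k 0| <= v k 0) ->
    forall l, `|(z + step t k *: (A i *m z)) l 0| <= (v + step t k *: (A i *m v)) l 0.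
  by near: k; exists k0.
have decay_k : `|iter k.+1 (mulmx (1%:M + step t k *: S)) (start i0 w)|
    <= c * expR (- (b * t)) * `|start i0 w|.
  by near: k; exact: decay.
rewrite /gap; set h := step t k in step_rel decay_k *.
have Vle : `|scheme_mean A (transition P r i0 h) h (fun=> fun z => `|z| ^+ m) k.+1 i0 x0|
    <= scheme_mean A (transition P r i0 h) h
         (fun j v => (xi *m start j v) 0 0) k.+1 i0 w.
  apply: (scheme_mean_le (transition_ge0 P r i0 h)
    (rel := fun z w => forall k, `|z k 0| <= w k 0)).
  - by move=> j z v; exact: step_rel.
  - move=> j z v zv; rewrite xiE ger0_norm ?exprn_ge0//.
    exact: norm_expr_le_sum.
  - by move=> k'; rewrite mxE.
apply: (le_trans (ler_norm _)); apply: (le_trans Vle).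
rewrite scheme_mean_momentmx; apply: (le_trans (ler_norm _)).
apply: (le_trans (row_mul_norm_le _ _)).
rewrite ler_wpM2l ?mxsize_ge0//.
rewrite -[X in `|X|](subrK (iter k.+1 (mulmx (1%:M + h *: S)) (start i0 w))).
by rewrite (le_trans (ler_normD _ _))// addrC lerD.
Unshelve. all: by end_near. Qed.

(** Linear functionals of the monomials are bounded by the m-th moment. The bounds
    allow, at each step size, for the difference between the powers of M(h) and
    those of 1 + h T_m, which vanishes in the limit. *)
Lemma moment_functional_le (xi : 'rV[R]_(N * nmon n m)) i0 x0 (t : R) (e : R) : 0 < t ->
  ('E_(P i0)[fun w => (`|x i0 x0 t w| ^+ m)%R] = e%:E)%E ->
  exists2 bound : R^nat, bound @ \oo --> mxsize xi * (vpow_size R n m * e) &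
  forall k, `|(xi *m iter k.+1 (mulmx (1%:M + step t k *: S)) (start i0 x0)) 0 0|
    <= bound k.
Proof.
move=> t0 Ee; have [e' Ee' cvge] := moment_limit r_chain (x_solution i0 x0) m t0.
have {Ee'}ee' : e' = e by move: Ee'; rewrite Ee => -[].
rewrite {}ee' in cvge.
pose V k := scheme_mean A (transition P r i0 (step t k)) (step t k)
    (fun=> fun z => `|z| ^+ m) k.+1 i0 x0.
pose gap k := `|iter k.+1 (mulmx (moments i0 (step t k))) (start i0 x0) -
    iter k.+1 (mulmx (1%:M + step t k *: S)) (start i0 x0)|.
exists (fun k => mxsize xi * (vpow_size R n m * V k + gap k)).
  apply: cvgMr; rewrite -[X in _ --> X]addr0; apply: cvgD; last exact: moments_cvg.
  by apply: cvgMr.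
move=> k; set h := step t k.
have V_le : `|(xi *m iter k.+1 (mulmx (moments i0 h)) (start i0 x0)) 0 0|
    <= mxsize xi * (vpow_size R n m * V k).
  rewrite -scheme_mean_momentmx mulrA -scheme_mean_scale.
  apply: (scheme_mean_le (transition_ge0 P r i0 h) (rel := eq)) => // [j z w ->//|j z _ <-].
  rewrite (le_trans (row_mul_norm_le _ _))// -mulrA ler_wpM2l ?mxsize_ge0//.
  by rewrite (le_trans (norm_place _ _))// norm_vpow_le.
set M := iter _ (mulmx (moments _ _)) _ in V_le.
set L := iter _ _ _.
have -> : (xi *m L) 0 0 = (xi *m M) 0 0 - (xi *m (M - L)) 0 0.
  by rewrite mulmxBr [(xi *m M - _) 0 0]mxE [(- (xi *m L)) 0 0]mxE opprB addrC subrK.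
rewrite (le_trans (ler_normB _ _))// mulrDr lerD// /gap -/h.
exact: row_mul_norm_le.
Qed.

(** For an eigenvalue z with nonnegative real part, the modulus of 1 + h z is at
    least 1, so that the functional given by the eigenvector does not decay; it is
    estimated through its real and imaginary parts a and b. *)
Lemma stable_hurwitz : exp_mean_stable P x m -> hurwitz S.
Proof.
move=> [C [beta [C0 beta0 stable]]] z /eigenvalueP[v vz v0].
rewrite ltNge; apply/negP => z0.
pose a : 'rV[R]_(N * nmon n m) := \row_l complex.Re (v 0 l).
pose b : 'rV[R]_(N * nmon n m) := \row_l complex.Im (v 0 l).
have vE (u : 'cV[R]_(N * nmon n m)) :
    (v *m map_mx (real_complex R) u) 0 0 = Complex ((a *m u) 0 0) ((b *m u) 0 0).
  apply/eqP; rewrite eq_complex /= !mxE !raddf_sum.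
  apply/andP; split; apply/eqP; apply: eq_bigr => l _; rewrite !mxE.
    by case: (v 0 l) => ? ? /=; rewrite mulr0 subr0.
  by case: (v 0 l) => ? ? /=; rewrite mulr0 add0r.
have [i0 [x0 y0]] : exists i0 x0,
    (a *m start i0 x0) 0 0 != 0 \/ (b *m start i0 x0) 0 0 != 0.
  apply: contrapT => no_y; case/eqP: v0; apply/rowP => l.
  have block_eq0 (xi : 'rV[R]_(N * nmon n m)) :
      (forall i0 x0, (xi *m start i0 x0) 0 0 = 0) -> xi = 0.
    move=> xi0; apply/rowP => l'; rewrite [RHS]mxE; case: (mxtens_indexP l') => i u.
    have : (\row_u xi 0 (mxtens_index (i, u)) : 'rV[R]_(nmon n m)) = 0.
      apply: vpow_span => w; apply/matrixP => k1 k2; rewrite (ord1 k1) (ord1 k2).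
      rewrite [RHS]mxE -[RHS](xi0 i w) mul_place mxE.
      by apply: eq_bigr => u' _; rewrite [X in X * _]mxE.
    by move/rowP/(_ u); rewrite !mxE.
  have a0 : a = 0.
    apply: block_eq0 => i0 x0; apply/eqP/negP => /negP an.
    by apply: no_y; exists i0, x0; left.
  have b0 : b = 0.
    apply: block_eq0 => i0 x0; apply/eqP/negP => /negP bn.
    by apply: no_y; exists i0, x0; right.
  have := congr1 (fun y : 'rV[R]__ => y 0 l) a0.
  have := congr1 (fun y : 'rV[R]__ => y 0 l) b0.
  by rewrite !mxE; case: (v 0 l) => ? ? /= -> ->.
pose N0 := ComplexField.Normc.normc ((v *m map_mx (real_complex R) (start i0 x0)) 0 0).
have N0_gt0 : 0 < N0.
  rewrite lt_neqAle normc_ge0 andbT eq_sym; apply/eqP => /ComplexField.Normc.eq0_normc.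
  by rewrite vE => -[a0 b0]; case: y0; rewrite ?a0 ?b0 eqxx.
have growth (h : R) k : 0 <= h -> N0 <= ComplexField.Normc.normc
    ((v *m map_mx (real_complex R) (iter k (mulmx (1%:M + h *: S)) (start i0 x0))) 0 0).
  move=> h0; elim: k => [|k IH]; first exact: lexx.
  apply: (le_trans IH); rewrite iterS.
  have vM : v *m map_mx (real_complex R) (1%:M + h *: S) = (1 + real_complex R h * z) *: v.
    rewrite map_mxD map_scalar_mx rmorph1 map_mxZ mulmxDr mulmx1.
    by rewrite -scalemxAr vz scalerA scalerDl scale1r.
  rewrite map_mxM mulmxA vM -scalemxAl.
  rewrite [in leRHS]mxE ComplexField.Normc.normcM ler_peMl ?normc_ge0//.
  case: (z) z0 => zr zi /= zr0.
  rewrite -[leLHS]sqrtr1 ler_sqrt; last by rewrite addr_ge0 ?sqr_ge0.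
  rewrite !mul0r subr0 !(addr0, add0r).
  have := mulr_ge0 h0 zr0; have := sqr_ge0 (h * zr); have := sqr_ge0 (h * zi); nra.
pose W := (mxsize a + mxsize b) * vpow_size R n m * (C * `|x0| ^+ m).
have W0 : 0 <= W.
  by rewrite !mulr_ge0 ?addr_ge0 ?mxsize_ge0 ?vpow_size_ge0 ?exprn_ge0// ltW.
have N0_le t : 0 < t -> N0 <= W * expR (- (beta * t)).
  move=> t0; have [e Ee _] := moment_limit r_chain (x_solution i0 x0) m t0.
  have e_le := stable i0 x0 t (ltW t0); rewrite Ee lee_fin in e_le.
  have [Ba Ba_cvg a_le] := moment_functional_le a t0 Ee.
  have [Bb Bb_cvg b_le] := moment_functional_le b t0 Ee.
  apply: (@le_trans _ _ (mxsize a * (vpow_size R n m * e) +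
      mxsize b * (vpow_size R n m * e))).
    apply: (ler_cvg_to (cvg_cst N0) (cvgD Ba_cvg Bb_cvg)); apply: nearW => k.
    apply: (le_trans (growth (step t k) k.+1 _)); first by rewrite divr_ge0// ltW.
    rewrite vE; apply: le_trans (lerD (a_le k) (b_le k)).
    set ya := (a *m _) 0 0; set yb := (b *m _) 0 0.
    rewrite /= -[leRHS]ger0_norm ?addr_ge0// -sqrtr_sqr ler_sqrt ?sqr_ge0//.
    by rewrite sqrrD !real_normK ?num_real// [leRHS]addrAC lerDl mulrn_wge0.
  have -> : W * expR (- (beta * t)) = (mxsize a + mxsize b) * vpow_size R n m *
    (C * expR (- (beta * t)) * `|x0| ^+ m) by rewrite /W; ring.
  rewrite -mulrDl mulrA ler_wpM2l// mulr_ge0 ?vpow_size_ge0//.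
  by rewrite addr_ge0 ?mxsize_ge0.
(* From N0 <= W exp (- beta t) follows N0 (1 + beta t) <= W, and this t makes the
   left-hand side N0 + W + 1. *)
pose t := (W + 1) / (N0 * beta).
have t0 : 0 < t by rewrite divr_gt0 ?mulr_gt0// ltr_wpDl.
have := N0_le t t0; rewrite expRN ler_pdivlMr ?expR_gt0// leNgt => /negP; apply.
apply: (@lt_le_trans _ _ (N0 * (1 + beta * t))); last first.
  by rewrite ler_wpM2l ?(ltW N0_gt0)// expR_ge1Dx.
have -> : N0 * (1 + beta * t) = N0 + W + 1 by rewrite /t; field; rewrite !gt_eqF.
by rewrite -addrA [W + 1]addrC addrA ltrDr addr_gt0.
Qed.

End stability.

Theorem theorem5p1 (R : realType) (d : measure_display) (T : measurableType d)
  (N n m : nat) (Q : 'M[R]_N) (A : 'I_N -> 'M[R]_n)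
  (P : 'I_N -> probability T R) (r : 'I_N -> R -> T -> 'I_N)
  (x : 'I_N -> 'cV[R]_n -> R -> T -> 'cV[R]_n)
  (Q_generator : generator Q)
  (r_chain : forall i0, markov_chain (P i0) Q i0 (r i0))
  (x_solution : forall i0 x0, trajectory (P i0) A (r i0) x0 (x i0 x0))
  (A_metzler : forall i, metzler (A i))
  (m_gt0 : (0 < m)%N) :
  exp_mean_stable P x m <-> hurwitz (Tmx m Q A).
Proof.
split; first exact: stable_hurwitz r_chain x_solution.
exact: hurwitz_stable r_chain x_solution m_gt0 A_metzler.
Qed.
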